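(* Let $T\in\Omega$ be a fixed tiling of $\mathbb R^d$, $d\in\mathbb N$. The map $$R'_s\to H_s,\qquad (x,y)\mapsto(T-x,T-y)$$ is a topological groupoid isomorphism, where $R'_s=\bigcup_{n\ge0}R_n$ is the inductive limit equivalence relation on $\mathbb R^d$ associated with $T$ and $H_s=H_s(T)=R_s\cap\big((T+\mathbb R^d)\times(T+\mathbb R^d)\big)$ is the transversal equivalence relation.
   Context: Tilings. A tiling $T$ of $\mathbb R^d$ is a CW-structure on $\mathbb R^d$ whose closed $d$-cells (the tiles) are homeomorphic to the closed unit disk; tiles may carry labels; $T$ is also regarded as the collection of its tiles, which cover $\mathbb R^d$ and meet only along boundaries. A patch is a finite set of tiles. For $X\subset\mathbb R^d$, $T(X)$ is the set of tiles of $T$ meeting $X$; $T(x):=T(\{x\})$; tilings agree on $X$ if $T(X)=T'(X)$. Fix prototiles $t_1,\dots,t_N$, $\lambda>1$, and a substitution $\omega$: $\omega(t_i)$ is a patch of translates of prototiles with union $\lambda t_i$, $\omega(t_i+x)=\omega(t_i)+\lambda x$, $\omega(P)=\bigcup_{t\in P}\omega(t)$. $\Omega$ is the set of tilings by translates of prototiles all of whose patches lie in a translate of some $\omega^k(t_j)$, with metric $d(T,T')=\inf(\{1/\sqrt2\}\cup\{\varepsilon>0:\exists |x|,|x'|<\varepsilon,\ T+x,T'+x'\text{ agree on }B_{1/\varepsilon}(0)\})$. Standing assumptions: finite local complexity, $\omega$ primitive, $\omega:\Omega\to\Omega$ injective (hence $\Omega$ is compact, without periodic tilings, $\omega$ is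 a homeomorphism and $(\Omega,d,\omega)$ is a Smale space). $R_s'$. For $n\in\mathbb N_0$, $R_n=\{(x,y)\in\mathbb R^d\times\mathbb R^d:\omega^n(T-x)(0)=\omega^n(T-y)(0)\}$ with the subspace topology of $\mathbb R^{2d}$; $R_0\subset R_1\subset\cdots$, and $R_s'=\bigcup_n R_n$ has the inductive limit topology. $R_s$. $T\sim_{R_s}T'$ iff $d(\omega^n(T),\omega^n(T'))\to0$. Let $0<\varepsilon_0<1/\sqrt2$ be the fixed small Smale-space constant of $(\Omega,d,\omega)$, and let $[\cdot,\cdot]$ be the Smale-space bracket ($[T,T']$ is the unique point in the local stable set of $T$ and the local unstable set of $T'$; explicitly $[T,T']=T'+x'-x$ when $T+x$ and $T'+x'$ agree on $B_{1/\varepsilon}(0)$ with $|x|,|x'|<\varepsilon$, $\varepsilon$ small). Put $V^s(T,\varepsilon)=\{T'\in\Omega:[T,T']=T',\ d(T,T')<\varepsilon\}$ for $0<\varepsilon\le\varepsilon_0$, $G_0^s=\{(T,T')\in\Omega\times\Omega:T'\in V^s(T,\varepsilon_0)\}$, $G_n^s=(\omega\times\omega)^{-n}(G_0^s)$ with the subspace topology of $\Omega\times\Omega$; then $R_s=\bigcup_nG^s_n$ (increasing) has the inductive limit topology. $T+\mathbb R^d$ and $H_s$. Put $V_n^u(T)=T+B_{2\varepsilon_0\lambda^n}(0)\subset\Omega$ with the subspace topology of $\Omega$; $T+\mathbb R^d=\bigcup_nV_n^u(T)$ is given the inductive limit topology (not the subspace topology of $\Omega$). $H_s=\{(T-x,T-y):\exists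 n\in\mathbb N_0,\ \omega^n(T-x)(0)=\omega^n(T-y)(0)\}$ carries the étale topology of Putnam–Spielberg, in which $(T-x_k,T-y_k)\to(T-x,T-y)$ if and only if $(T-x_k,T-y_k)\to(T-x,T-y)$ in $R_s$, and $T-x_k\to T-x$ and $T-y_k\to T-y$ in $T+\mathbb R^d$ (inductive limit topology). A topological groupoid isomorphism is a groupoid isomorphism that is a homeomorphism. *)

(* Defs.v *)
From HB Require Import structures.
From mathcomp Require Import all_boot all_order all_algebra.
From mathcomp Require Import all_classical all_reals all_analysis.
From mathcomp Require Import ring lra.
Set Implicit Arguments.
Unset Strict Implicit.
Unset Printing Implicit Defensive.
Import Order.TTheory GRing.Theory Num.Theory.
Import numFieldNormedType.Exports.
Local Open Scope classical_set_scope.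
Local Open Scope ring_scope.

(** The library norm on ['rV[R]_k] is the sup norm, so the Euclidean norm is
    introduced separately; both induce the library topology of ['rV[R]_k]. *)
Section Euclidean.
Variable R : realType.

Definition enorm k (x : 'rV[R]_k) : R := Num.sqrt (\sum_i x 0 i ^+ 2).

Definition eball k (x : 'rV[R]_k) (r : R) : set 'rV[R]_k :=
  [set y | enorm (y - x) < r].

Definition open_disk k : set 'rV[R]_k := [set x | enorm x < 1].
Definition closed_disk k : set 'rV[R]_k := [set x | enorm x <= 1].
Definition unit_sphere k : set 'rV[R]_k := [set x | enorm x = 1].

Lemma sum_sqr_ge0 k (x : 'rV[R]_k) : 0 <= \sum_i x 0 i ^+ 2.
Proof. by apply: sumr_ge0 => i _; exact: sqr_ge0. Qed.

Lemma enorm_ge0 k (x : 'rV[R]_k) : 0 <= enorm x.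
Proof. exact: sqrtr_ge0. Qed.

Lemma enorm0 k : enorm (0 : 'rV[R]_k) = 0.
Proof.
rewrite /enorm big1 ?sqrtr0// => i _.
by rewrite mxE expr0n.
Qed.

Lemma enormN k (x : 'rV[R]_k) : enorm (- x) = enorm x.
Proof.
by congr (Num.sqrt _); apply: eq_bigr => i _; rewrite mxE sqrrN.
Qed.

Lemma sum_mul_le_enorm k (x y : 'rV[R]_k) :
  \sum_i x 0 i * y 0 i <= enorm x * enorm y.
Proof.
set a := enorm x; set b := enorm y.
have a2 : \sum_i x 0 i ^+ 2 = a ^+ 2 by rewrite sqr_sqrtr// sum_sqr_ge0.
have b2 : \sum_i y 0 i ^+ 2 = b ^+ 2 by rewrite sqr_sqrtr// sum_sqr_ge0.
set c := \sum_i _.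
have main (u v : R) : 0 <= u ^+ 2 * a ^+ 2 - 2 * u * v * c + v ^+ 2 * b ^+ 2.
  suff -> : u ^+ 2 * a ^+ 2 - 2 * u * v * c + v ^+ 2 * b ^+ 2 =
      \sum_i (u * x 0 i - v * y 0 i) ^+ 2.
    by apply: sumr_ge0 => i _; exact: sqr_ge0.
  rewrite -a2 -b2 /c !mulr_sumr -sumrB -big_split/=.
  by apply: eq_bigr => i _; ring.
have a0 : 0 <= a by exact: enorm_ge0.
have b0 : 0 <= b by exact: enorm_ge0.
have [ab0|ab0] := ltP 0 (a * b).
  have := main b a.
  have -> : b ^+ 2 * a ^+ 2 - 2 * b * a * c + a ^+ 2 * b ^+ 2 =
      2 * (a * b) * (a * b - c) by ring.
  by rewrite pmulr_rge0 ?subr_ge0// mulr_gt0.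
have ab : a * b = 0 by apply/eqP; rewrite eq_le ab0 mulr_ge0.
rewrite ab leNgt; apply/negP => c0.
have /eqP := ab; rewrite mulf_eq0 => /orP[] /eqP h.
- have := main ((b ^+ 2 + 1) / c) 1; rewrite h.
  have -> : ((b ^+ 2 + 1) / c) ^+ 2 * 0 ^+ 2 - 2 * ((b ^+ 2 + 1) / c) * 1 * c
     + 1 ^+ 2 * b ^+ 2 = - b ^+ 2 - 2 by field; rewrite gt_eqF.
  by have := sqr_ge0 b; lra.
- have := main 1 ((a ^+ 2 + 1) / c); rewrite h.
  have -> : 1 ^+ 2 * a ^+ 2 - 2 * 1 * ((a ^+ 2 + 1) / c) * c
     + ((a ^+ 2 + 1) / c) ^+ 2 * 0 ^+ 2 = - a ^+ 2 - 2 by field; rewrite gt_eqF.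
  by have := sqr_ge0 a; lra.
Qed.

Lemma enorm_triangle k (x y : 'rV[R]_k) : enorm (x + y) <= enorm x + enorm y.
Proof.
rewrite -(@ler_pXn2r _ 2)// ?nnegrE ?enorm_ge0 ?addr_ge0 ?enorm_ge0//.
have E z : \sum_i (z : 'rV[R]_k) 0 i ^+ 2 = enorm z ^+ 2.
  by rewrite sqr_sqrtr// sum_sqr_ge0.
have -> : enorm (x + y) ^+ 2 =
    enorm x ^+ 2 + 2 * (\sum_i x 0 i * y 0 i) + enorm y ^+ 2.
  rewrite -!E mulr_sumr -!big_split/=.
  by apply: eq_bigr => i _; rewrite mxE; ring.
have := sum_mul_le_enorm x y; rewrite sqrrD; lra.
Qed.

End Euclidean.
Arguments open_disk {R} k.
Arguments closed_disk {R} k.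
Arguments unit_sphere {R} k.

Section Topology.

Definition homeo_on (X Y : topologicalType) (A : set X) (B : set Y)
    (f : X -> Y) : Prop :=
  set_bij A B f /\ {within A, continuous f} /\
  exists g : Y -> X, {within B, continuous g} /\ (forall x, A x -> g (f x) = x).

Definition homeomorphic (X Y : topologicalType) (A : set X) (B : set Y) : Prop :=
  exists f : X -> Y, homeo_on A B f.

Definition homeomorphism (X Y : topologicalType) (f : X -> Y) : Prop :=
  continuous f /\ exists g : Y -> X, [/\ continuous g, cancel f g & cancel g f].

Definition frontier (X : topologicalType) (A : set X) : set X :=
  closure A `\` interior A.

Definition is_cw_structure (R : realType) (X : topologicalType) (I : Type)
    (dim : I -> nat) (Phi : forall i, 'rV[R]_(dim i) -> X) : Prop :=
  let cell i := Phi i @` open_disk (dim i) in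
  let closed_cell i := Phi i @` closed_disk (dim i) in
  [/\ forall i, {within closed_disk (dim i), continuous (Phi i)} /\
                homeo_on (open_disk (dim i)) (cell i) (Phi i),
      forall x, exists! i, cell i x,
      forall i, exists J : set I,
        [/\ finite_set J, forall j, J j -> (dim j < dim i)%N &
            Phi i @` unit_sphere (dim i) `<=` \bigcup_(j in J) cell j] &
      forall A : set X, (forall i, closed (A `&` closed_cell i)) -> closed A].

End Topology.

(** The set [A], filtered by the [E n], with the inductive limit of the
    subspace topologies of the [E n] in [X]. *)
Definition indlim (X : topologicalType) (A : set X) (E : nat -> set X) : Type :=
  {x : X | A x}.

Section InductiveLimit.
Variables (X : topologicalType) (A : set X) (E : nat -> set X).
Local Notation indlim := (indlim A E).

Definition indlim_open (U : set indlim) : Prop :=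
  forall n, exists2 O : set X, open O &
    forall u : indlim, E n (sval u) -> (U u <-> O (sval u)).

Lemma indlim_openT : indlim_open setT.
Proof. by move=> n; exists setT => //; exact: openT. Qed.

Lemma indlim_openI : setI_closed indlim_open.
Proof.
move=> U V oU oV n; have [W oW UW] := oU n; have [P oP VP] := oV n.
exists (W `&` P); first exact: openI.
by move=> u Eu; split=> -[a b]; split; [apply/UW|apply/VP|apply/UW|apply/VP].
Qed.

Lemma indlim_open_bigU (I : Type) (f : I -> set indlim) :
  (forall i, indlim_open (f i)) -> indlim_open (\bigcup_i f i).
Proof.
move=> of_ n.
have /choice[W HW] i : exists W : set X, open W /\
    forall u : indlim, E n (sval u) -> (f i u <-> W (sval u)).
  by have [W oW fW] := of_ i n; exists W.
exists (\bigcup_i W i); first by apply: bigcup_open => i _; exact: (HW i).1.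
by move=> u Eu; split=> -[i _ h]; exists i => //; apply/(HW i).2.
Qed.

HB.instance Definition _ := gen_eqMixin indlim.
HB.instance Definition _ := gen_choiceMixin indlim.
HB.instance Definition _ := isOpenTopological.Build indlim
  indlim_openT indlim_openI indlim_open_bigU.

End InductiveLimit.

Section Groupoid.

Definition is_eqrel_on (X : Type) (U : set X) (E : set (X * X)) : Prop :=
  [/\ forall x y, E (x, y) -> U x /\ U y,
      forall x, U x -> E (x, x),
      forall x y, E (x, y) -> E (y, x) &
      forall x y z, E (x, y) -> E (y, z) -> E (x, z)].

(** The groupoid of an equivalence relation [E] has arrows the pairs in [E];
    [(x, y)] and [(y', z)] are composable iff [y = y'], with product [(x, z)],
    and the inverse of [(x, y)] is [(y, x)]. *)
Definition arrow_comp (X : Type) (E : set (X * X)) (g h k : {p | E p}) : Prop :=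
  (sval g).2 = (sval h).1 /\ sval k = ((sval g).1, (sval h).2).

Definition arrow_inv (X : Type) (E : set (X * X)) (g h : {p | E p}) : Prop :=
  sval h = ((sval g).2, (sval g).1).

Definition groupoid_iso (X Y : Type) (U : set X) (V : set Y)
    (E : set (X * X)) (E' : set (Y * Y)) (F : {p | E p} -> {q | E' q}) : Prop :=
  [/\ is_eqrel_on U E, is_eqrel_on V E', bijective F,
      forall g h k, arrow_comp g h k <-> arrow_comp (F g) (F h) (F k) &
      forall g h, arrow_inv g h <-> arrow_inv (F g) (F h)].

End Groupoid.

Section Tilings.
Variables (R : realType) (d : nat) (L : Type).
Local Notation pt := 'rV[R]_d.

Definition tile : Type := (set pt * L)%type.

Definition tile_shift (x : pt) (t : tile) : tile :=
  ([set z + x | z in t.1], t.2).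

Definition tiling_shift (x : pt) (T : set tile) : set tile :=
  [set tile_shift x t | t in T].

(** [patch_at T X] is T(X). *)
Definition patch_at (T : set tile) (X : set pt) : set tile :=
  [set t | T t /\ t.1 `&` X !=set0].

Definition agree_on (T T' : set tile) (X : set pt) : Prop :=
  patch_at T X = patch_at T' X.

(** A tiling is identified with its set of labelled tiles, so the CW-structure
    is only required to exist. *)
Definition is_tiling (T : set tile) : Prop :=
  [/\ exists (I : Type) (dim : I -> nat) (Phi : forall i, 'rV[R]_(dim i) -> pt),
        is_cw_structure Phi /\
        [set A | exists2 i, dim i = d & A = Phi i @` closed_disk (dim i)] =
        [set t.1 | t in T],
      forall t, T t -> homeomorphic t.1 (closed_disk d : set pt),
      forall t t', T t -> T t' -> t.1 = t'.1 -> t = t',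
      \bigcup_(t in T) t.1 = setT &
      forall t t', T t -> T t' -> t <> t' ->
        t.1 `&` t'.1 `<=` frontier t.1 `&` frontier t'.1].

Definition close_upto (e : R) (T T' : set tile) : Prop :=
  exists x x' : pt, [/\ enorm x < e, enorm x' < e &
    agree_on (tiling_shift x T) (tiling_shift x' T') (eball 0 e^-1)].

Definition tdist (T T' : set tile) : R :=
  inf ([set (Num.sqrt 2)^-1] `|` [set e | 0 < e /\ close_upto e T T']).

Lemma tile_shiftD x y t :
  tile_shift (x + y) t = tile_shift y (tile_shift x t).
Proof.
congr pair => /=; rewrite image_comp; apply: eq_imagel => z _ /=.
by rewrite addrA.
Qed.

Lemma tiling_shiftD x y T : tiling_shift (x + y) T = tiling_shift y (tiling_shift x T).
Proof.
rewrite /tiling_shift image_comp; apply: eq_imagel => t _ /=.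
by rewrite tile_shiftD.
Qed.

Lemma agree_onS T T' (X Y : set pt) : Y `<=` X ->
  agree_on T T' X -> agree_on T T' Y.
Proof.
move=> YX h.
have sub S S' : agree_on S S' X -> patch_at S Y `<=` patch_at S' Y.
  move=> h' t [St [z [tz Yz]]].
  have : patch_at S X t by split => //; exists z; split => //; exact: YX.
  by rewrite h' => -[S't _]; split => //; exists z.
by apply/seteqP; split; apply: sub => //; exact: esym.
Qed.

Lemma agree_on_shift v T T' (X : set pt) : agree_on T T' X ->
  agree_on (tiling_shift v T) (tiling_shift v T') [set z + v | z in X].
Proof.
move=> h.
have sub S S' : agree_on S S' X ->
    patch_at (tiling_shift v S) [set z + v | z in X] `<=`
    patch_at (tiling_shift v S') [set z + v | z in X].
  move=> h' _ [[t St <-] [_ [[z tz <-] [w Xw /addIr wz]]]].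
  have : patch_at S X t by split => //; exists z; split => //; rewrite -wz.
  rewrite h' => -[S't _]; split; first by exists t.
  by exists (z + v); split; [exists z|exists w => //; rewrite wz].
by apply/seteqP; split; apply: sub => //; exact: esym.
Qed.

Lemma close_upto_sym (e : R) T T' : close_upto e T T' -> close_upto e T' T.
Proof. by move=> [x [x' [? ? ?]]]; exists x', x; split => //; exact: esym. Qed.

Lemma invsqrt2_gt0 : 0 < (Num.sqrt 2 : R)^-1.
Proof. by rewrite invr_gt0 sqrtr_gt0. Qed.

Lemma invsqrt2_lt1 : (Num.sqrt 2 : R)^-1 < 1.
Proof.
rewrite invf_lt1 ?sqrtr_gt0// -[ltLHS]sqrtr1 ltr_sqrt//; lra.
Qed.

Lemma close_upto_triangle (e1 e2 : R) T1 T2 T3 : 0 < e1 -> 0 < e2 -> e1 + e2 <= 1 ->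
  close_upto e1 T1 T2 -> close_upto e2 T2 T3 -> close_upto (e1 + e2) T1 T3.
Proof.
move=> e10 e20 e12 [x [x' [xe x'e h]]] [y [y' [ye y'e h']]].
exists (x + y), (y' + x'); split.
- by apply: le_lt_trans (enorm_triangle _ _) _; exact: ltrD.
- by apply: le_lt_trans (enorm_triangle _ _) _; rewrite (addrC e1) ltrD.
have radius (a b : R) (v : pt) : 0 < a -> 0 < b -> a + b <= 1 ->
    enorm v < b -> eball 0 (a + b)^-1 `<=` [set z + v | z in eball 0 a^-1].
  move=> a0 b0 ab vb z; rewrite /eball/= subr0 => zab.
  exists (z - v); last by rewrite subrK.
  rewrite subr0; apply: le_lt_trans (enorm_triangle _ _) _; rewrite enormN.
  apply: lt_le_trans (ltrD zab vb) _.
  rewrite -subr_ge0.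
  have -> : a^-1 - ((a + b)^-1 + b) = b * (1 - a * (a + b)) / (a * (a + b)).
    by field; rewrite !gt_eqF ?addr_gt0.
  have a1 : a <= 1 by lra.
  have h1 : a * (a + b) <= 1 by apply: le_trans ab; rewrite ger_pMl ?addr_gt0.
  apply: divr_ge0; last by rewrite mulr_ge0 ?addr_ge0// ltW.
  by apply: mulr_ge0; [exact: ltW|rewrite subr_ge0].
have A := agree_onS (radius _ _ _ e10 e20 e12 ye) (agree_on_shift y h).
rewrite addrC in e12.
have B := agree_onS (radius _ _ _ e20 e10 e12 x'e) (agree_on_shift x' h').
rewrite addrC in B.
rewrite -!tiling_shiftD in A B; rewrite addrC in A.
by rewrite /agree_on addrC A (addrC x') B.
Qed.

Lemma tdist_has_lbound T T' :
  has_lbound ([set (Num.sqrt 2)^-1] `|` [set e | 0 < e /\ close_upto e T T']).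
Proof.
exists 0 => e [ee|[e0 _]]; last exact: ltW.
by rewrite ee ltW ?invsqrt2_gt0.
Qed.

Lemma tdist_ltP T T' (e : R) : tdist T T' < e <->
  (Num.sqrt 2)^-1 < e \/ exists2 e', 0 < e' < e & close_upto e' T T'.
Proof.
split.
- move=> h; have [|e' + e'e] := inf_lt _ h; first by exists (Num.sqrt 2)^-1; left.
  move=> [ee'|[e'0 c]]; first by left; rewrite -ee'.
  by right; exists e' => //; rewrite e'0.
- move=> [h|[e' /andP[e'0 e'e] c]].
    by apply: le_lt_trans h; apply: ge_inf; [exact: tdist_has_lbound|left].
  by apply: le_lt_trans e'e; apply: ge_inf; [exact: tdist_has_lbound|right].
Qed.

Lemma tdist_gt0 T T' (e : R) : tdist T T' < e -> 0 < e.
Proof.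
move=> /tdist_ltP[h|[e' /andP[a b] _]]; last exact: lt_trans b.
by apply: lt_trans h; exact: invsqrt2_gt0.
Qed.

Lemma tdist_center T (e : R) : 0 < e -> tdist T T < e.
Proof.
move=> e0; apply/tdist_ltP; right.
have h0 : 0 < e / 2 by lra.
exists (e / 2); first by rewrite h0; lra.
by exists 0, 0; rewrite !enorm0; split.
Qed.

Lemma tdist_sym T T' (e : R) : tdist T T' < e -> tdist T' T < e.
Proof.
move=> /tdist_ltP[h|[e' h c]]; apply/tdist_ltP; [by left|right].
by exists e' => //; exact: close_upto_sym.
Qed.

Lemma tdist_triangle T1 T2 T3 (e1 e2 : R) :
  tdist T1 T2 < e1 -> tdist T2 T3 < e2 -> tdist T1 T3 < e1 + e2.
Proof.
move=> h1 h2; have p1 := tdist_gt0 h1; have p2 := tdist_gt0 h2.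
apply/tdist_ltP.
move/tdist_ltP : h1 => [h1|[a /andP[a0 ae] ca]]; first by left; lra.
move/tdist_ltP : h2 => [h2|[b /andP[b0 be] cb]]; first by left; lra.
have [ab|ab] := leP (a + b) 1; last by left; have := invsqrt2_lt1; lra.
right; exists (a + b); first by apply/andP; split; lra.
exact: close_upto_triangle ca cb.
Qed.

Record substitution := Substitution {
  nproto : nat ;
  proto : 'I_nproto -> tile ;
  infl : R ;
  subst : 'I_nproto -> set tile ;
  infl_gt1 : 1 < infl ;
  proto_disk : forall i, homeomorphic (proto i).1 (closed_disk d : set pt) ;
  subst_finite : forall i, finite_set (subst i) ;
  subst_proto : forall i t, subst i t -> exists j x, t = tile_shift x (proto j) ;
  subst_support : forall i,
    \bigcup_(t in subst i) t.1 = [set infl *: z | z in (proto i).1] ;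
  (* the extension to translates is well defined *)
  subst_compat : forall i j x, proto j = tile_shift x (proto i) ->
    subst j = tiling_shift (infl *: x) (subst i) }.

Section Hull.
Variable s : substitution.

Definition inflate (P : set tile) : set tile :=
  [set t | exists (i : 'I_(nproto s)) x, P (tile_shift x (proto i)) /\
                       tiling_shift (infl s *: x) (subst i) t].

Definition supertile k (j : 'I_(nproto s)) : set tile := iter k inflate [set proto j].

Definition hull (T : set tile) : Prop :=
  [/\ is_tiling T,
      forall t, T t -> exists (i : 'I_(nproto s)) x, t = tile_shift x (proto i) &
      forall P, finite_set P -> P `<=` T ->
        exists k (j : 'I_(nproto s)) x, P `<=` tiling_shift x (supertile k j)].

Definition finite_local_complexity : Prop := forall r : R, 0 < r ->
  exists F : set (set tile), [/\ finite_set F, forall P, F P -> finite_set P &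
    forall T x, hull T -> exists P v, F P /\ patch_at T (eball x r) = tiling_shift v P].

Definition primitive : Prop := exists2 k, (0 < k)%N &
  forall i j : 'I_(nproto s), exists x, supertile k i (tile_shift x (proto j)).

Record standing_assumptions : Prop := StandingAssumptions {
  standing_flc : finite_local_complexity ;
  standing_primitive : primitive ;
  standing_stable : forall T, hull T -> hull (inflate T) ;
  standing_inj : forall T T', hull T -> hull T' -> inflate T = inflate T' -> T = T' }.

Definition Omega : Type := {T : set tile | hull T}.

Definition Omega_dist (T T' : Omega) : R := tdist (sval T) (sval T').

Definition Omega_ball (T : Omega) (e : R) : set Omega :=
  [set T' | Omega_dist T T' < e].

Lemma Omega_ball_center T e : 0 < e -> Omega_ball T e T.
Proof. exact: tdist_center. Qed.

Lemma Omega_ball_sym T T' e : Omega_ball T e T' -> Omega_ball T' e T.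
Proof. exact: tdist_sym. Qed.

Lemma Omega_ball_triangle T1 T2 T3 e1 e2 :
  Omega_ball T1 e1 T2 -> Omega_ball T2 e2 T3 -> Omega_ball T1 (e1 + e2) T3.
Proof. exact: tdist_triangle. Qed.

HB.instance Definition _ := gen_eqMixin Omega.
HB.instance Definition _ := gen_choiceMixin Omega.
HB.instance Definition _ :=
  hasNbhs.Build Omega (nbhs_ (entourage_ Omega_ball)).
HB.instance Definition _ := @Nbhs_isPseudoMetric.Build R Omega
  (entourage_ Omega_ball) erefl Omega_ball Omega_ball_center Omega_ball_sym
  Omega_ball_triangle erefl.

End Hull.
End Tilings.

Section Relations.
Variables (R : realType) (d : nat) (L : Type) (s : substitution R d L).
Local Notation pt := 'rV[R]_d.
Local Notation Omega := (Omega s).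

Definition Rn (T : set (tile R d L)) (n : nat) : set (pt * pt) :=
  [set p | patch_at (iter n (inflate s) (tiling_shift (- p.1) T)) [set 0] =
           patch_at (iter n (inflate s) (tiling_shift (- p.2) T)) [set 0]].

Definition Rprime_rel (T : set (tile R d L)) : set (pt * pt) :=
  \bigcup_n Rn T n.

Definition Rprime (T : set (tile R d L)) : Type := indlim (Rprime_rel T) (Rn T).
HB.instance Definition _ T := Topological.on (Rprime T).

Variable hs : standing_assumptions s.

Definition omega (T : Omega) : Omega :=
  exist _ (inflate s (sval T)) (standing_stable hs (svalP T)).

Local Notation dist := (@Omega_dist R d L s).

(** The axioms of a Smale space for (Ω, d, ω), with the bracket meaningful only
    at distance at most [eps0]. The contraction of ω^-1 on unstable sets is
    stated without inverting ω. *)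
Record is_smale_bracket (eps0 : R) (bracket : Omega -> Omega -> Omega) : Prop :=
SmaleBracket {
  bracket_continuous :
    {within [set p : Omega * Omega | dist p.1 p.2 <= eps0],
      continuous (fun p => bracket p.1 p.2)} ;
  bracket_id : forall x, bracket x x = x ;
  bracket_r : forall x y z, dist y z <= eps0 -> dist x (bracket y z) <= eps0 ->
    dist x z <= eps0 -> bracket x (bracket y z) = bracket x z ;
  bracket_l : forall x y z, dist x y <= eps0 -> dist (bracket x y) z <= eps0 ->
    dist x z <= eps0 -> bracket (bracket x y) z = bracket x z ;
  bracket_omega : forall x y, dist x y <= eps0 ->
    dist (omega x) (omega y) <= eps0 ->
    omega (bracket x y) = bracket (omega x) (omega y) ;
  bracket_contract : exists2 mu : R, 0 < mu < 1 &
    (forall y z, dist y z <= eps0 -> bracket y z = z ->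
       dist (omega y) (omega z) <= mu * dist y z) /\
    (forall y z, dist (omega y) (omega z) <= eps0 ->
       bracket (omega y) (omega z) = omega y ->
       dist y z <= mu * dist (omega y) (omega z)) ;
  bracket_explicit : forall (T T' : Omega) (e : R) (x x' : pt),
    0 < e <= eps0 -> enorm x < e -> enorm x' < e ->
    agree_on (tiling_shift x (sval T)) (tiling_shift x' (sval T')) (eball 0 e^-1) ->
    sval (bracket T T') = tiling_shift (x' - x) (sval T') }.

Variables (eps0 : R) (bracket : Omega -> Omega -> Omega).

Definition Vs (T : Omega) (e : R) : set Omega :=
  [set T' | bracket T T' = T' /\ dist T T' < e].

Definition Gs (n : nat) : set (Omega * Omega) :=
  [set p | Vs (iter n omega p.1) eps0 (iter n omega p.2)].

Definition Rs_rel : set (Omega * Omega) :=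
  [set p | (fun n => dist (iter n omega p.1) (iter n omega p.2)) @ \oo --> 0].

Definition Rs : Type := indlim Rs_rel Gs.
HB.instance Definition _ := Topological.on Rs.

Definition leaf_set (T : Omega) : set Omega :=
  [set S | exists x : pt, sval S = tiling_shift x (sval T)].

Definition Vu (T : Omega) (n : nat) : set Omega :=
  [set S | exists2 x : pt, enorm x < 2 * eps0 * infl s ^+ n &
                           sval S = tiling_shift x (sval T)].

Definition leaf (T : Omega) : Type := indlim (leaf_set T) (Vu T).
HB.instance Definition _ T := Topological.on (leaf T).

Definition Hs_rel (T : Omega) : set (Omega * Omega) :=
  Rs_rel `&` (leaf_set T `*` leaf_set T).

(** [eps] and [b] are phantom: they determine the topology declared below. *)
Definition Hs_space (eps : R) (b : Omega -> Omega -> Omega) (T : Omega) : Type :=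
  {p : Omega * Omega | Hs_rel T p}.
Local Notation Hs := (Hs_space eps0 bracket).

Section HsTopology.
Variable T : Omega.

Definition Hs_to_Rs (h : Hs T) : Rs := exist _ (sval h) (svalP h).1.

Definition Hs_fst (h : Hs T) : leaf T := exist _ (sval h).1 (svalP h).2.1.

Definition Hs_snd (h : Hs T) : leaf T := exist _ (sval h).2 (svalP h).2.2.

Definition Hs_cvg (u : nat -> Hs T) (h : Hs T) : Prop :=
  [/\ (fun k => Hs_to_Rs (u k)) @ \oo --> Hs_to_Rs h,
      (fun k => Hs_fst (u k)) @ \oo --> Hs_fst h &
      (fun k => Hs_snd (u k)) @ \oo --> Hs_snd h].

(** The étale topology of H_s is second countable, hence determined by its
    convergent sequences: a set is open iff every sequence converging to one of
    its points is eventually in it. *)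
Definition Hs_open (U : set (Hs T)) : Prop :=
  forall u h, Hs_cvg u h -> U h -> \forall k \near \oo, U (u k).

Lemma Hs_openT : Hs_open setT.
Proof. by move=> u h _ _; exact: nearW. Qed.

Lemma Hs_openI : setI_closed Hs_open.
Proof.
by move=> U V oU oV u h uh [Uh Vh]; apply: filterI; [exact: oU uh _|exact: oV uh _].
Qed.

Lemma Hs_open_bigU (I : Type) (f : I -> set (Hs T)) :
  (forall i, Hs_open (f i)) -> Hs_open (\bigcup_i f i).
Proof.
move=> of_ u h uh [i _ fh]; apply: filterS (of_ i u h uh fh).
by move=> k fk; exists i.
Qed.

HB.instance Definition _ := gen_eqMixin (Hs T).
HB.instance Definition _ := gen_choiceMixin (Hs T).
HB.instance Definition _ := isOpenTopological.Build (Hs T)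
  Hs_openT Hs_openI Hs_open_bigU.

End HsTopology.
End Relations.

(* Main.v *)
Require Import Defs.
From HB Require Import structures.
From mathcomp Require Import all_boot all_order all_algebra.
From mathcomp Require Import all_classical all_reals all_analysis.
From mathcomp Require Import lra.
Set Implicit Arguments.
Unset Strict Implicit.
Unset Printing Implicit Defensive.
Import Order.TTheory GRing.Theory Num.Theory.
Import numFieldNormedType.Exports.
Local Open Scope classical_set_scope.
Local Open Scope ring_scope.

(** Algebra. The map is injective because the tilings of the hull have no period
    ([aperiodic]). Indeed the hull is minimal ([patch_occurs]), so a period of one
    tiling is a period of all; if [v] is a period of [T], it is therefore one of
    [omega T], and injectivity of [omega] makes [v / lambda] a period of [T].
    Iterating gives arbitrarily short periods, which is absurd, since every tile
    contains a ball that meets no other tile ([hull_private_point]). The image is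
    the whole of [H_s] because two tilings [A] and [B] are stably equivalent exactly
    when [omega^n A] and [omega^n B] have the same tiles at the origin for some [n].
    If they have, they agree on a small ball around the origin, and inflation makes
    the ball grow ([agree_Rs_rel]). Conversely ([Rs_rel_agree]), if the orbits
    approach each other, [omega^n A] and [omega^n B + u_n] agree on a large ball for
    some small [u_n]. The explicit form of the bracket and aperiodicity make such a
    vector unique ([small_shift_unique]), whence [u_(n+1) = lambda u_n], and this
    stays small only if [u_n = 0].

    Topology. All the topologies involved are determined by sequences. A sequence
    converging inside one [R_n] consists, from some point on, of diagonal translates
    of its limit, because the finite patch at the origin admits no small
    translations between its tiles ([Rn_etale]); the corresponding pairs of tilings
    then agree on a fixed ball, so they lie in one piece of [R_s] ([Rn_Gs]).
    Conversely, convergence in the leaf forces the translation vectors to converge: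
    on bounded sets of vectors, translation of [T] is an injective continuous map
    from a compact space to the Hausdorff space [Omega] ([leaf_cvg]). A sequence
    converging in the inductive limit [R_s] stays in one of its pieces
    ([indlim_cvg_bounded]), and the [n]-th piece only contains pairs that have the
    same tiles at the origin after [n] inflations ([Gs_agree]), so the sequence stays
    in one [R_n]. *)

(** * The Euclidean norm and the topology of row vectors *)

Section EuclideanTopology.
Variables (R : realType) (k : nat).
Implicit Types (x y z : 'rV[R]_k) (r : R).

Lemma enormZ r x : enorm (r *: x) = `|r| * enorm x.
Proof.
rewrite /enorm -sqrtr_sqr -sqrtrM ?sqr_ge0// mulr_sumr.
by congr (Num.sqrt _); apply: eq_bigr => i _; rewrite mxE exprMn.
Qed.

Lemma enormB x y : enorm (x - y) = enorm (y - x).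
Proof. by rewrite -opprB enormN. Qed.

Lemma coord_le_enorm x i : `|x 0 i| <= enorm x.
Proof.
rewrite -sqrtr_sqr ler_wsqrtr// (bigD1 i)//= lerDl.
by apply: sumr_ge0 => j _; exact: sqr_ge0.
Qed.

Lemma norm_le_enorm x : `|x| <= enorm x.
Proof.
rewrite [leLHS]/Num.Def.normr/= mx_normrE; apply: bigmax_le => [|[i j] _ /=].
  exact: enorm_ge0.
by rewrite (ord1 i); exact: coord_le_enorm.
Qed.

Lemma enorm_eq0 x : enorm x = 0 -> x = 0.
Proof.
by move=> x0; apply/eqP; rewrite -normr_eq0 eq_le normr_ge0 -x0 norm_le_enorm.
Qed.

Lemma enorm_le_norm x : enorm x <= k%:R * `|x|.
Proof.
have le_norm i : `|x 0 i| <= `|x|.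
  by rewrite [leRHS]/Num.Def.normr/= mx_normrE; apply: (le_bigmax _ _ (ord0, i)).
have [k0|k0] := posnP k.
  by rewrite /enorm big1 ?sqrtr0 ?mulr_ge0// => i; have := ltn_ord i; rewrite {2}k0.
rewrite -(@ger0_norm _ (k%:R * `|x|)) ?mulr_ge0// -sqrtr_sqr ler_wsqrtr//.
apply: le_trans (_ : \sum_(i < k) `|x| ^+ 2 <= _).
  by apply: ler_sum => i _; rewrite -[x 0 i ^+ 2]real_normK ?num_real// lerXn2r ?nnegrE.
rewrite sumr_const card_ord -[leLHS]mulr_natl exprMn ler_wpM2r ?sqr_ge0//.
by rewrite expr2 ler_peMl// ler1n.
Qed.

Lemma nbhs_eballP x (A : set 'rV[R]_k) :
  nbhs x A <-> exists2 r, 0 < r & eball x r `<=` A.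
Proof.
split=> [/nbhs_ballP[e /= e0 xA]|[r r0 xA]].
  exists e => // y xy; apply: xA; rewrite mx_norm_ball /ball_/= distrC.
  exact: le_lt_trans (norm_le_enorm _) xy.
apply/nbhs_ballP; exists (r / k.+1%:R) => /=; first by rewrite divr_gt0.
move=> y; rewrite mx_norm_ball /ball_/= => xy; apply: xA; rewrite /eball/= enormB.
apply: le_lt_trans (enorm_le_norm _) _.
apply: le_lt_trans (_ : k.+1%:R * `|x - y| < _).
  by rewrite ler_wpM2r// ler_nat.
by rewrite mulrC -ltr_pdivlMr.
Qed.

Lemma nbhs_eball x r : 0 < r -> nbhs x (eball x r).
Proof. by move=> r0; apply/nbhs_eballP; exists r. Qed.

Lemma cvg_enormP (a : nat -> 'rV[R]_k) x : a @ \oo --> x <->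
  forall r, 0 < r -> \forall n \near \oo, enorm (a n - x) < r.
Proof.
split=> [ax r r0|ax A /nbhs_eballP[r r0 rA]]; first exact: (ax _ (nbhs_eball x r0)).
suff : \forall n \near \oo, A (a n) by [].
by apply: filterS (ax r r0) => n; exact: rA.
Qed.

Lemma enorm_lip x y : `|enorm x - enorm y| <= enorm (x - y).
Proof.
rewrite ler_norml; have := enorm_triangle (x - y) y; rewrite subrK => xy.
have := enorm_triangle (y - x) x; rewrite subrK enormB; lra.
Qed.

Lemma enorm_continuous : continuous (@enorm R k).
Proof.
move=> x A /nbhs_ballP[e /= e0 xA]; apply/nbhs_eballP; exists e => // y xy.
by apply: xA; rewrite /ball/=; apply: le_lt_trans (enorm_lip _ _) _; rewrite enormB.
Qed.

Lemma closed_enorm_le r : closed [set x : 'rV[R]_k | enorm x <= r].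
Proof.
apply: (@preimage_closed _ _ (@enorm R k) [set y | y <= r]); last exact: closed_le.
by move=> x _; exact: enorm_continuous.
Qed.

Lemma compact_enorm_le r : compact [set x : 'rV[R]_k | enorm x <= r].
Proof.
apply: bounded_closed_compact; last exact: closed_enorm_le.
exists r; split; first exact: num_real.
move=> M rM x /= xr; apply: le_trans (norm_le_enorm _) _.
exact: le_trans xr (ltW rM).
Qed.

Lemma compact_enorm_bounded (A : set 'rV[R]_k) : compact A ->
  exists2 M, 0 < M & forall x, A x -> enorm x < M.
Proof.
move=> /compact_bounded[M [_ AM]]; exists (k%:R * (`|M| + 1) + 1).
  by rewrite ltr_pwDr// mulr_ge0// addr_ge0.
move=> x Ax; apply: le_lt_trans (enorm_le_norm _) _.
apply: (@le_lt_trans _ _ (k%:R * (`|M| + 1))); last by rewrite ltrDl.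
rewrite ler_wpM2l//; apply: AM => //.
by apply: le_lt_trans (ler_norm _) _; rewrite ltrDl.
Qed.

Lemma compact_closed_rV (A : set 'rV[R]_k) : compact A -> closed A.
Proof. by apply: compact_closed; exact: norm_hausdorff. Qed.

End EuclideanTopology.

(** * Translations of tilings *)

Section Shifts.
Variables (R : realType) (d : nat) (L : Type).
Local Notation pt := 'rV[R]_d.
Implicit Types (t : tile R d L) (S T : set (tile R d L)) (x v z : pt).

Lemma tile_shift0 t : tile_shift 0 t = t.
Proof.
case: t => A l; congr pair; rewrite -[RHS]image_id.
by apply: eq_imagel => z _ /=; rewrite addr0.
Qed.

Lemma tiling_shift0 T : tiling_shift 0 T = T.
Proof.
by rewrite -[RHS]image_id; apply: eq_imagel => t _ /=; rewrite tile_shift0.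
Qed.

Lemma tile_shiftK x : cancel (@tile_shift R d L x) (tile_shift (- x)).
Proof. by move=> t; rewrite -tile_shiftD subrr tile_shift0. Qed.

Lemma tile_shiftNK x : cancel (@tile_shift R d L (- x)) (tile_shift x).
Proof. by move=> t; rewrite -tile_shiftD addNr tile_shift0. Qed.

Lemma tiling_shiftK x : cancel (@tiling_shift R d L x) (tiling_shift (- x)).
Proof. by move=> T; rewrite -tiling_shiftD subrr tiling_shift0. Qed.

Lemma mem_tile_shift x t z : (tile_shift x t).1 z <-> t.1 (z - x).
Proof.
split=> [[y ty <-]|tz]; first by rewrite addrK.
by exists (z - x) => //; rewrite subrK.
Qed.

Lemma mem_tiling_shift x T t : tiling_shift x T t <-> T (tile_shift (- x) t).
Proof.
split=> [[t' Tt' <-]|Tt]; first by rewrite tile_shiftK.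
by exists (tile_shift (- x) t) => //; rewrite tile_shiftNK.
Qed.

Lemma tiling_shift_mem x T t : T t -> tiling_shift x T (tile_shift x t).
Proof. by move=> Tt; exists t. Qed.

Lemma tiling_shiftS x S T : S `<=` T -> tiling_shift x S `<=` tiling_shift x T.
Proof. exact: image_subset. Qed.

Lemma agree_on_shift_ball v S T r r' : enorm v + r' <= r ->
  agree_on S T (eball 0 r) ->
  agree_on (tiling_shift v S) (tiling_shift v T) (eball 0 r').
Proof.
move=> vr ST; apply: agree_onS (agree_on_shift v ST) => z; rewrite /eball/= subr0 => zr'.
exists (z - v); last by rewrite subrK.
by rewrite subr0; have := enorm_triangle z (- v); rewrite enormN; lra.
Qed.

Lemma agree_on_shift0 v S T r : enorm v < r -> agree_on S T (eball 0 r) ->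
  agree_on (tiling_shift v S) (tiling_shift v T) [set 0].
Proof.
move=> vr ST; apply: agree_onS (agree_on_shift v ST) => _ ->.
by exists (- v); rewrite ?addNr// /eball/= subr0 enormN.
Qed.

Lemma eballS (r r' : R) : r <= r' -> eball (0 : pt) r `<=` eball 0 r'.
Proof. by move=> rr' z; rewrite /eball/=; move/lt_le_trans; apply. Qed.

End Shifts.

(** * Inflation and agreement of tilings *)

Section Inflation.
Variables (R : realType) (d : nat) (L : Type) (s : substitution R d L).
Local Notation pt := 'rV[R]_d.
Local Notation lam := (infl s).
Implicit Types (t q : tile R d L) (P Q S T : set (tile R d L)) (x z : pt).

Lemma infl_gt0 : 0 < lam.
Proof. exact: lt_trans (infl_gt1 s). Qed.

Lemma infl_neq0 n : lam ^+ n != 0.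
Proof. by rewrite expf_neq0// gt_eqF// infl_gt0. Qed.

Lemma infl_unbounded (r : R) : \forall n \near \oo, r < lam ^+ n.
Proof.
have h : (lam^-1 ^+ n) @[n --> \oo] --> (0 : R).
  apply: cvg_expr; rewrite ger0_norm ?invr_ge0 ?(ltW infl_gt0)//.
  by rewrite invf_lt1 ?infl_gt0 ?infl_gt1.
have /cvgrPdist_lt/(_ (`|r| + 1)^-1) := h.
rewrite invr_gt0 ltr_pwDr// => /(_ isT); apply: filterS => n.
rewrite sub0r normrN ger0_norm ?exprn_ge0 ?invr_ge0 ?(ltW infl_gt0)//.
rewrite exprVn ltf_pV2 ?posrE ?exprn_gt0 ?infl_gt0 ?ltr_pwDr// => rn.
by apply: le_lt_trans (ler_norm _) _; apply: lt_trans rn; rewrite ltrDl.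
Qed.

Lemma inflate_shift x P :
  inflate s (tiling_shift x P) = tiling_shift (lam *: x) (inflate s P).
Proof.
apply/seteqP; split=> t.
  move=> [i [y [/mem_tiling_shift]]]; rewrite -tile_shiftD => Pi ti.
  apply/mem_tiling_shift; exists i, (y - x); split => //.
  by apply/mem_tiling_shift; rewrite -tile_shiftD scalerBr opprB addKr; exact/mem_tiling_shift.
move=> /mem_tiling_shift[i [y [Pi /mem_tiling_shift]]].
rewrite -tile_shiftD -opprD -scalerDr => ti; exists i, (x + y); split.
  by apply/mem_tiling_shift; rewrite -tile_shiftD addrAC subrr add0r.
exact/mem_tiling_shift.
Qed.

Lemma iter_inflate_shift n x P :
  iter n (inflate s) (tiling_shift x P) =
  tiling_shift (lam ^+ n *: x) (iter n (inflate s) P).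
Proof.
elim: n => [|n IH] /=; first by rewrite expr0 scale1r.
by rewrite IH inflate_shift scalerA -exprS.
Qed.

Lemma iter_inflateS n P Q : P `<=` Q ->
  iter n (inflate s) P `<=` iter n (inflate s) Q.
Proof.
move=> PQ; elim: n => [|n IH] //= t [i [x [Pi ti]]].
by exists i, x; split => //; exact: IH.
Qed.

Lemma iter_inflate_parent n P t : iter n (inflate s) P t ->
  exists2 q, P q & iter n (inflate s) [set q] t.
Proof.
elim: n t => [|n IH] t /=; first by exists t.
move=> [i [x [/IH[q Pq qi] ti]]]; exists q => //.
by exists i, x; split.
Qed.

Lemma inflate_support P t z : inflate s P t -> t.1 z ->
  exists q y, [/\ P q, q.1 y & z = lam *: y].
Proof.
move=> [i [x [Pi /mem_tiling_shift ti]]] tz.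
have : (\bigcup_(t in subst (s := s) i) t.1) (z - lam *: x).
  exists (tile_shift (- (lam *: x)) t) => //.
  by apply/mem_tile_shift; rewrite opprK subrK.
rewrite subst_support => -[y iy yz]; exists (tile_shift x (proto i)), (y + x).
split => //; first by apply/mem_tile_shift; rewrite addrK.
by rewrite scalerDr yz subrK.
Qed.

Lemma iter_inflate_support n q t z : iter n (inflate s) [set q] t -> t.1 z ->
  exists2 y, q.1 y & z = lam ^+ n *: y.
Proof.
elim: n t z => [|n IH] t z /=.
  by move=> -> qz; exists z => //; rewrite expr0 scale1r.
move=> /inflate_support h /h[q' [y [q't q'y ->]]].
have [y' qy' ->] := IH _ _ q't q'y.
by exists y' => //; rewrite scalerA -exprS.
Qed.

(** Tiles of an inflated patch lie in the inflated tiles they come from, so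
    those meeting [lam ^+ n *: X] come from tiles meeting [X]. *)
Lemma agree_inflate n S T (X : set pt) : agree_on S T X ->
  agree_on (iter n (inflate s) S) (iter n (inflate s) T)
    [set lam ^+ n *: z | z in X].
Proof.
move=> ST.
have sub P Q : agree_on P Q X ->
    patch_at (iter n (inflate s) P) [set lam ^+ n *: z | z in X] `<=`
    patch_at (iter n (inflate s) Q) [set lam ^+ n *: z | z in X].
  move=> PQ t [Pt [w [tw [z Xz zw]]]]; split; last by exists w; split => //; exists z.
  rewrite -zw in tw.
  have [q Pq qt] := iter_inflate_parent Pt.
  have [y qy] := iter_inflate_support qt tw.
  move=> /(scalerI (infl_neq0 n)) zy.
  have : patch_at P X q by split => //; exists y; split => //; rewrite -zy.
  by rewrite PQ => -[Qq _]; apply: iter_inflateS qt => _ ->.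
by apply/seteqP; split; apply: sub => //; exact: esym.
Qed.

Lemma agree_inflate0 n S T : agree_on S T [set 0] ->
  agree_on (iter n (inflate s) S) (iter n (inflate s) T) [set 0].
Proof. by move=> /(agree_inflate n); rewrite image_set1 scaler0. Qed.

Lemma agree_inflate_ball n S T r : agree_on S T (eball 0 r) ->
  agree_on (iter n (inflate s) S) (iter n (inflate s) T) (eball 0 (lam ^+ n * r)).
Proof.
move=> /(agree_inflate n); apply: agree_onS => z; rewrite /eball/= subr0 => zr.
exists ((lam ^+ n)^-1 *: z); last by rewrite scalerA divff ?infl_neq0// scale1r.
have l0 : 0 < lam ^+ n by rewrite exprn_gt0// infl_gt0.
by rewrite subr0 enormZ ger0_norm ?invr_ge0 ?ltW// mulrC ltr_pdivrMr// mulrC.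
Qed.

End Inflation.

(** * Translations preserve tilings *)

Section Transport.
Variables (Y Z : topologicalType) (h : Y -> Z) (h' : Z -> Y).
Hypotheses (ch : continuous h) (ch' : continuous h').
Hypotheses (hK : cancel h h') (h'K : cancel h' h).

Lemma homeo_on_compl (X : topologicalType) (A : set X) (B : set Y) (f : X -> Y) :
  homeo_on A B f -> homeo_on A (h @` B) (h \o f).
Proof.
move=> [[fAB finj fsurj] [cf [g [cg gK]]]]; split; first split.
- by move=> x Ax; exists (f x) => //; exact: fAB.
- by move=> x y Ax Ay /(can_inj hK); exact: finj.
- by move=> _ [y /fsurj[x Ax <-] <-]; exists x.
split; first by apply: within_continuous_comp => // ? _; exact: ch.
exists (g \o h'); split; last by move=> x Ax /=; rewrite hK gK.
apply/subspace_continuousP => _ [y By <-].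
apply: (@cvg_comp _ _ _ h' g _ (within B (nbhs y))); last first.
  by move/subspace_continuousP : cg => /(_ y By); rewrite -{2}(hK y).
move=> U; rewrite /within/= => yU.
have : nbhs (h y) (h' @^-1` [set z | B z -> U z]).
  by apply: ch'; rewrite hK.
by apply: filterS => z /= zU [w Bw zw]; apply: zU; rewrite -zw hK.
Qed.

Lemma homeo_on_compr (X : topologicalType) (A : set Y) (B : set X) (f : Y -> X) :
  homeo_on A B f -> homeo_on (h @` A) B (f \o h').
Proof.
move=> [[fAB finj fsurj] [cf [g [cg gK]]]]; split; first split.
- by move=> _ [y Ay <-] /=; rewrite hK; exact: fAB.
- move=> _ _ /set_mem[y Ay <-] /set_mem[z Az <-] /=; rewrite !hK => yz.
  by congr h; apply: finj => //; apply/mem_set.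
- by move=> _ /fsurj[y Ay <-]; exists (h y); [exists y|rewrite /= hK].
split; last first.
  exists (h \o g); split; last by move=> _ [y Ay <-] /=; rewrite hK gK.
  by apply: within_continuous_comp => // ? _; exact: ch.
apply/subspace_continuousP => _ [y Ay <-].
apply: (@cvg_comp _ _ _ h' f _ (within A (nbhs y))); last first.
  by move/subspace_continuousP : cf => /(_ y Ay); rewrite -{2}(hK y).
move=> U; rewrite /within/= => yU.
have : nbhs (h y) (h' @^-1` [set z | A z -> U z]).
  by apply: ch'; rewrite hK.
by apply: filterS => z /= zU [w Aw zw]; apply: zU; rewrite -zw hK.
Qed.

Lemma frontier_homeo (A : set Y) y : frontier A y -> frontier (h @` A) (h y).
Proof.
move=> [clA intA]; split.
  move=> U /ch/clA[z [Az Uz]].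
  by exists (h z); split => //; exists z.
move=> hA; apply: intA.
apply: (@filterS _ (nbhs y) _ (h @^-1` (h @` A))); last exact: (ch hA).
by move=> z [w Aw /(can_inj hK) <-].
Qed.

Lemma cw_structure_homeo (R : realType) (I : Type) (dim : I -> nat)
    (Phi : forall i, 'rV[R]_(dim i) -> Y) :
  is_cw_structure Phi -> is_cw_structure (fun i => h \o Phi i).
Proof.
move=> [Phi_c cells bd weak]; split => [i|z|i|A clA].
- have [cPhi hPhi] := Phi_c i; split.
    by apply: within_continuous_comp => // ? _; exact: ch.
  by rewrite -image_comp; exact: homeo_on_compl.
- have [i [[w wd wz] iu]] := cells (h' z); exists i; split.
    by exists w => //=; rewrite wz h'K.
  move=> j [w' w'd w'z]; apply: iu; exists w' => //.
  by rewrite -w'z /= hK.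
- have [J [Jfin Jdim Jbd]] := bd i; exists J; split => //.
  move=> _ [w wS <-] /=.
  have [j Jj [w' w'd w'w]] := Jbd _ (imageP (Phi i) wS).
  by exists j => //; exists w' => //=; rewrite w'w.
- have -> : A = h' @^-1` (h @^-1` A) by apply/seteqP; split=> z /=; rewrite h'K.
  apply: preimage_closed => [z _|]; first exact: ch'.
  apply: weak => i.
  have -> : h @^-1` A `&` Phi i @` closed_disk (dim i) =
      h @^-1` (A `&` (h \o Phi i) @` closed_disk (dim i)).
    apply/seteqP; split=> y /= [Ay [w wd wy]]; split => //; exists w => //.
      by rewrite wy.
    exact: (can_inj hK).
  by apply: preimage_closed => [z _|]; [exact: ch|exact: clA].
Qed.

End Transport.

Lemma homeo_on_compact (X Y : topologicalType) (A : set X) (B : set Y) f :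
  homeo_on A B f -> compact B -> compact A.
Proof.
move=> [[fAB _ fsurj] [_ [g [cg gK]]]] cB.
suff -> : A = g @` B by exact: continuous_compact.
apply/seteqP; split=> [x Ax|_ [_ /fsurj[x Ax <-] <-]]; last by rewrite gK.
by exists (f x); [exact: fAB|exact: gK].
Qed.

Section Tiles.
Variables (R : realType) (d : nat) (L : Type).
Local Notation pt := 'rV[R]_d.
Implicit Types (t : tile R d L) (S T : set (tile R d L)) (x v z : pt).

Lemma translation_continuous x : continuous (fun z : pt => z + x).
Proof.
move=> z A /nbhs_eballP[e e0 zA]; apply/nbhs_eballP; exists e => // y zy.
by apply: zA; rewrite /eball/= opprD addrACA subrr addr0.
Qed.

Lemma is_tiling_shift x T : is_tiling T -> is_tiling (tiling_shift x T).
Proof.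
move=> [[I [dim [Phi [cw cells]]]] disks inj cover meet].
pose h (z : pt) := z + x; pose h' (z : pt) := z + - x.
have ch : continuous h by exact: translation_continuous.
have ch' : continuous h' by exact: translation_continuous.
have hK : cancel h h' by move=> z; rewrite /h/h' addrK.
have h'K : cancel h' h by move=> z; rewrite /h/h' subrK.
split.
- exists I, dim, (fun i => h \o Phi i); split.
    exact: (cw_structure_homeo ch ch' hK h'K cw).
  apply/seteqP; split=> A.
    move=> [i di ->]; have : [set t.1 | t in T] (Phi i @` closed_disk (dim i)).
      by rewrite -cells; exists i.
    move=> [t Tt tE]; exists (tile_shift x t); first exact: tiling_shift_mem.
    by rewrite -image_comp -tE.
  move=> [_ [t Tt <-] <-]; have : [set t.1 | t in T] t.1 by exists t.
  rewrite -cells => -[i di tE]; exists i => //.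
  by rewrite -image_comp -tE.
- move=> _ [t /disks[f ft] <-]; exists (f \o h').
  exact: (homeo_on_compr ch ch' hK ft).
- move=> _ _ [t Tt <-] [t' Tt' <-] tt'; congr (tile_shift x).
  apply: inj => //; apply/seteqP; split=> z tz.
    have : (tile_shift x t).1 (h z) by exact: imageP.
    by rewrite tt' => -[w t'w /(can_inj hK) <-].
  have : (tile_shift x t').1 (h z) by exact: imageP.
  by rewrite -tt' => -[w t'w /(can_inj hK) <-].
- apply/seteqP; split=> // z _.
  have : (\bigcup_(t in T) t.1) (z - x) by rewrite cover.
  move=> [t Tt tz]; exists (tile_shift x t); first exact: tiling_shift_mem.
  exact/mem_tile_shift.
- move=> _ _ [t Tt <-] [t' Tt' <-] tt' z [[w tw <-] [w' t'w' /addIr w'w]].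
  have {}tt' : t <> t' by move=> tt; apply: tt'; rewrite tt.
  have [] : (frontier t.1 `&` frontier t'.1) w.
    by apply: (meet _ _ Tt Tt' tt'); split => //; rewrite -w'w.
  by move=> ? ?; split; apply: (frontier_homeo ch hK).
Qed.

Lemma disk_compact (A : set pt) :
  homeomorphic A (closed_disk d : set pt) -> compact A.
Proof. by move=> [f fA]; apply: homeo_on_compact fA (@compact_enorm_le _ _ 1). Qed.

Lemma disk_nonempty (A : set pt) :
  homeomorphic A (closed_disk d : set pt) -> A !=set0.
Proof.
move=> [f [[_ _ fsurj] _]]; have [|x Ax _] := fsurj 0; last by exists x.
by rewrite /closed_disk/= enorm0 ler01.
Qed.

(** Iterating a non-trivial translation leaves every bounded set, so a tile, being
    non-empty and compact, is fixed only by the trivial one. *)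
Lemma tile_shift_inj t x y : t.1 !=set0 -> compact t.1 ->
  tile_shift x t = tile_shift y t -> x = y.
Proof.
move=> [z tz] /compact_enorm_bounded[M M0 tM] xy.
have {}xy : tile_shift (x - y) t = t by rewrite tile_shiftD xy tile_shiftK.
have tn n : t.1 (z + (x - y) *+ n).
  elim: n => [|n IH]; first by rewrite mulr0n addr0.
  by rewrite -xy; apply/mem_tile_shift; rewrite mulrSr addrA addrK.
apply/eqP; rewrite -subr_eq0; apply/eqP/enorm_eq0/eqP.
rewrite eq_le enorm_ge0 andbT leNgt; apply/negP => v0.
(* The translate of [z] by [n.+1] steps is more than [2 * M] away from [z]. *)
pose n := Num.truncn (2 * M / enorm (x - y)).
have := tM _ (tn n.+1); have := tM _ tz.
have := enorm_triangle (z + (x - y) *+ n.+1) (- z).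
rewrite addrAC subrr add0r enormN -scaler_nat enormZ ger0_norm//.
have : 2 * M / enorm (x - y) < n.+1%:R by exact: truncnS_gt.
by rewrite ltr_pdivrMr//; lra.
Qed.

End Tiles.

(** * The hull: local finiteness, minimality and aperiodicity *)

Section Hull.
Variables (R : realType) (d : nat) (L : Type) (s : substitution R d L).
Hypothesis hs : standing_assumptions s.
Local Notation pt := 'rV[R]_d.
Local Notation lam := (infl s).
Local Notation hull := (hull s).
Local Notation proto := (proto (s := s)).
Implicit Types (t q : tile R d L) (P Q S T : set (tile R d L)) (x v z : pt).

Lemma hull_shift x T : hull T -> hull (tiling_shift x T).
Proof.
move=> [tilT protoT patchT]; split; first exact: is_tiling_shift.
  move=> _ [t /protoT[i [y ->]] <-]; exists i, (y + x).
  by rewrite tile_shiftD.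
move=> P Pfin PT.
have [||k [j [y Py]]] := patchT (tiling_shift (- x) P).
- exact: finite_image.
- by rewrite -[T](tiling_shiftK x); exact: tiling_shiftS.
- exists k, j, (y + x); rewrite tiling_shiftD -[P](tiling_shiftK (- x)) opprK.
  exact: tiling_shiftS.
Qed.

Lemma hull_iter n T : hull T -> hull (iter n (inflate s) T).
Proof. by move=> hT; elim: n => //= n; exact: standing_stable. Qed.

Lemma hull_compact T t : hull T -> T t -> compact t.1.
Proof. by move=> [[_ disks _ _ _] _ _] Tt; apply: disk_compact; exact: disks. Qed.

Lemma hull_nonempty T t : hull T -> T t -> t.1 !=set0.
Proof. by move=> [[_ disks _ _ _] _ _] Tt; apply: disk_nonempty; exact: disks. Qed.

Lemma hull_cover T z : hull T -> exists2 t, T t & t.1 z.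
Proof.
move=> [[_ _ _ cover _] _ _].
by have : (\bigcup_(t in T) t.1) z by rewrite cover.
Qed.

Lemma hull_tile_shift_inj T t x y : hull T -> T t ->
  tile_shift x t = tile_shift y t -> x = y.
Proof.
move=> hT Tt; apply: tile_shift_inj; first exact: hull_nonempty hT Tt.
exact: hull_compact hT Tt.
Qed.

Lemma hull_locally_finite T x r : hull T -> finite_set (patch_at T (eball x r)).
Proof.
move=> hT; have r1 : 0 < `|r| + 1 by rewrite ltr_pwDr.
have [F [_ Ffin hF]] := standing_flc hs r1.
have [P [v [FP TP]]] := hF T x hT.
apply: (@sub_finite_set _ _ (patch_at T (eball x (`|r| + 1)))).
  move=> t [Tt [z [tz zr]]]; split => //; exists z; split => //.
  apply: lt_le_trans zr _; apply: le_trans (ler_norm _) _.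
  by rewrite lerDl.
by rewrite TP; apply: finite_image; exact: Ffin.
Qed.

(** Tiles are closed and locally finite in number, so those avoiding [z] stay
    away from it. *)
Lemma hull_separated T z : hull T ->
  exists2 r, 0 < r & forall t, T t -> t.1 `&` eball z r !=set0 -> t.1 z.
Proof.
move=> hT; pose Z := [set t : {classic tile R d L} |
  patch_at T (eball z 1) t /\ ~ t.1 z].
have Zc : closed (\bigcup_(t in Z) t.1).
  apply: closed_bigcup => [|t [[Tt _] _]].
    by apply: sub_finite_set (hull_locally_finite z 1 hT) => t [].
  by apply: compact_closed_rV; exact: hull_compact hT Tt.
have : nbhs z (~` (\bigcup_(t in Z) t.1)).
  apply: open_nbhs_nbhs; split; first exact: closed_openC.
  by move=> [t [_ ntz] tz].
move=> /nbhs_eballP[r r0 zr]; exists (Num.min r 1).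
  by rewrite lt_min r0 ltr01.
move=> t Tt [w [tw]]; rewrite /eball/= lt_min => /andP[wr w1].
apply: contrapT => ntz; apply: (zr w wr); exists t => //.
by split => //; split => //; exists w.
Qed.

Lemma patch_at_ball T : hull T -> exists2 r, 0 < r &
  forall r', 0 < r' <= r -> patch_at T (eball 0 r') = patch_at T [set 0].
Proof.
move=> hT; have [r r0 sep] := hull_separated 0 hT; exists r => // r' /andP[r'0 r'r].
apply/seteqP; split=> t [Tt [z [tz zr]]]; split => //.
  exists 0; split => //; apply: sep => //; exists z; split => //.
  exact: lt_le_trans r'r.
by exists z; split => //; rewrite zr /eball/= subrr enorm0.
Qed.

Lemma agree_on0_ball S T : hull S -> hull T -> agree_on S T [set 0] ->
  exists2 r, 0 < r & agree_on S T (eball 0 r).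
Proof.
move=> hS hT ST; have [r r0 Sr] := patch_at_ball hS.
have [r' r'0 Tr'] := patch_at_ball hT.
have m0 : 0 < Num.min r r' by rewrite lt_min r0.
exists (Num.min r r') => //.
by rewrite /agree_on Sr ?Tr' ?m0 ?ge_min ?lexx ?orbT.
Qed.

(** The centre of the open cell of [t] lies in no other closed cell, since cells
    are disjoint and the boundary of a tile only meets cells of lower dimension. *)
Lemma hull_private_point T t : hull T -> T t ->
  exists z r, [/\ 0 < r, t.1 z &
    forall t', T t' -> t'.1 `&` eball z r !=set0 -> t' = t].
Proof.
move=> hT Tt; have [[[I [dim [Phi [cw cells]]]] _ inj _ _] _ _] := hT.
have [_ disj bd _] := cw.
have cell_of t' : T t' -> exists2 i, dim i = d & t'.1 = Phi i @` closed_disk (dim i).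
  move=> Tt'; have : [set t.1 | t in T] t'.1 by exists t'.
  by rewrite -cells.
have [i di ti] := cell_of _ Tt.
have i0 : (Phi i @` open_disk (dim i)) (Phi i 0).
  by exists 0 => //; rewrite /open_disk/= enorm0.
have tz : t.1 (Phi i 0).
  by rewrite ti; exists 0 => //; rewrite /closed_disk/= enorm0.
(* A closed cell through [Phi i 0] meets it either in its open cell, which is then
   [cell i], or in a cell of dimension less than [d], which is impossible. *)
have only t' : T t' -> t'.1 (Phi i 0) -> t' = t.
  move=> Tt'; have [j dj t'j] := cell_of _ Tt'; rewrite t'j => -[w wd wz].
  have [k [_ ku]] := disj (Phi i 0).
  have ki := ku _ i0.
  have [w1|w1] := ltP (enorm w) 1.
    have kj : k = j by apply: ku; exists w.
    by apply: inj => //; rewrite ti t'j -ki kj.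
  have [J [_ Jdim Jbd]] := bd j.
  have [|l Jl lz] := Jbd (Phi j w).
    by exists w => //; apply/eqP; rewrite eq_le w1 andbT.
  rewrite wz in lz; have := Jdim _ Jl.
  by rewrite -(ku _ lz) ki di dj ltnn.
have [r r0 sep] := hull_separated (Phi i 0) hT.
exists (Phi i 0), r; split => // t' Tt' h.
by apply: only => //; exact: sep.
Qed.

Lemma proto_diam : exists2 M, 0 < M &
  forall i x z, (proto i).1 x -> (proto i).1 z -> enorm (x - z) < M.
Proof.
have /choice[M HM] (i : 'I_(nproto s)) : exists M,
    0 < M /\ forall x z, (proto i).1 x -> (proto i).1 z -> enorm (x - z) < M.
  have [M M0 iM] := compact_enorm_bounded (disk_compact (proto_disk i)).
  exists (M + M); split=> [|x z /iM xM /iM zM]; first exact: addr_gt0.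
  by have := enorm_triangle x (- z); rewrite enormN; lra.
exists (1 + \sum_i M i).
  by rewrite ltr_pwDl// sumr_ge0// => i _; rewrite ltW// (HM i).1.
move=> i x z ix iz; apply: lt_le_trans ((HM i).2 _ _ ix iz) _.
rewrite (bigD1 i)//= addrCA lerDl addr_ge0// sumr_ge0// => j _.
by rewrite ltW// (HM j).1.
Qed.

Lemma iter_inflate_tile_shift n x t :
  iter n (inflate s) [set tile_shift x t] =
  tiling_shift (lam ^+ n *: x) (iter n (inflate s) [set t]).
Proof. by rewrite -iter_inflate_shift /tiling_shift image_set1. Qed.

(** By primitivity a high power of the substitution turns any prototile into a
    patch containing translates of all the others. *)
Lemma supertile_sub : exists k0, forall k i j, exists x,
  tiling_shift x (supertile (s := s) k j) `<=` supertile (s := s) (k + k0) i.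
Proof.
have [k0 _ prim] := standing_primitive hs; exists k0 => k i j.
have [x ijx] := prim i j; exists (lam ^+ k *: x).
rewrite /supertile -iter_inflate_tile_shift iterD.
by apply: iter_inflateS => _ ->.
Qed.

(** This is what prevents the tiles of a supertile from overlapping, which the
    substitution rule does not say by itself: [T] contains some prototile, whose
    inflations contain every supertile by primitivity. *)
Lemma supertile_in_hull T k j : hull T ->
  exists2 S, hull S & supertile (s := s) k j `<=` S.
Proof.
move=> hT; have [t Tt _] := hull_cover 0 hT.
have [_ protoT _] := hT; have [i [y ty]] := protoT t Tt.
have [k0 /(_ k i j)[x kj]] := supertile_sub.
pose v := x + lam ^+ (k + k0) *: y.
exists (tiling_shift (- v) (iter (k + k0) (inflate s) T)).
  exact/hull_shift/hull_iter.
rewrite -[supertile _ _](tiling_shiftK v); apply: tiling_shiftS.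
rewrite tiling_shiftD; apply: subset_trans (tiling_shiftS kj) _.
rewrite /supertile -iter_inflate_tile_shift -ty.
by apply: iter_inflateS => _ ->.
Qed.

(** A large ball in [T] is covered by a single supertile; its order is large
    because its diameter is, so it splits into supertiles of order [m], and the
    one at the centre of the ball lies entirely in [T]. The non-zero vector [v]
    provides a direction in which the ball really is long. *)
Lemma supertile_occurs T m v : hull T -> v != 0 ->
  exists i y, tiling_shift y (supertile (s := s) m i) `<=` T.
Proof.
move=> hT v0; have [M M0 diam] := proto_diam.
have lam0 k : 0 < lam ^+ k by rewrite exprn_gt0// infl_gt0.
have diam_iter k i a q' q'' z w : iter k (inflate s) [set tile_shift a (proto i)] q' ->
    iter k (inflate s) [set tile_shift a (proto i)] q'' -> q'.1 z -> q''.1 w ->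
    enorm (z - w) < lam ^+ k * M.
  move=> h' h'' q'z q''w; have [y /mem_tile_shift iy ->] := iter_inflate_support h' q'z.
  have [y' /mem_tile_shift iy' ->] := iter_inflate_support h'' q''w.
  rewrite -scalerBr enormZ ger0_norm ?ltW// ltr_pM2l//.
  have -> : y - y' = (y - a) - (y' - a) by rewrite opprB addrA subrK.
  exact: diam iy iy'.
pose r := lam ^+ m * M + 1.
have r0 : 0 < r by rewrite ltr_pwDr// mulr_ge0// ltW.
have [_ _ patchT] := hT.
have := patchT _ (hull_locally_finite 0 r hT) (fun t h => h.1).
move=> [k [j [x PS]]].
have inS z : enorm z < r -> exists t, [/\ T t, t.1 z, patch_at T (eball 0 r) t &
    supertile (s := s) k j (tile_shift (- x) t)].
  move=> zr; have [t Tt tz] := hull_cover z hT; exists t.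
  have Pt : patch_at T (eball 0 r) t.
    by split => //; exists z; split => //; rewrite /eball/= subr0.
  by split => //; apply/mem_tiling_shift; exact: PS.
have [t0 [Tt0 t00 _ St0]] : exists t, [/\ T t, t.1 0, patch_at T (eball 0 r) t &
    supertile (s := s) k j (tile_shift (- x) t)] by apply: inS; rewrite enorm0.
have mk : (m <= k)%N.
  rewrite leqNgt; apply/negP => km.
  have ev : 0 < enorm v.
    rewrite lt_neqAle enorm_ge0 andbT eq_sym; apply: contra_neq v0; exact: enorm_eq0.
  (* The points [0] and [z] of the ball are too far apart for order [k < m]. *)
  pose z := ((lam ^+ m * M) / enorm v) *: v.
  have ez : enorm z = lam ^+ m * M.
    rewrite enormZ ger0_norm ?divr_ge0 ?mulr_ge0 ?ltW//.
    by rewrite divfK// gt_eqF.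
  have [|t [_ tz _ St]] := inS z; first by rewrite ez ltrDl.
  rewrite /supertile -[proto j]tile_shift0 in St St0.
  have t0x : (tile_shift (- x) t0).1 (- x) by apply/mem_tile_shift; rewrite subrr.
  have tx : (tile_shift (- x) t).1 (z - x) by apply/mem_tile_shift; rewrite opprK subrK.
  have := diam_iter _ _ _ _ _ _ _ St St0 tx t0x.
  rewrite opprK subrK ez ltr_pM2r// ltr_eXn2l ?infl_gt1// => mk.
  by move: km; rewrite ltnNge (ltnW mk).
move: (St0); rewrite /supertile -(subnKC mk) iterD => /iter_inflate_parent[q qk qt0].
have [i [a qa]] : exists i a, q = tile_shift a (proto i).
  move: qk; case: (k - m)%N => [->|n /=]; first by exists j, 0; rewrite tile_shift0.
  move=> [i [a [_ [u iu <-]]]]; have [i' [b ->]] := subst_proto iu.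
  by exists i', (b + lam *: a); rewrite tile_shiftD.
rewrite qa in qt0 qk; exists i, (lam ^+ m *: a + x).
rewrite tiling_shiftD -iter_inflate_tile_shift => _ [g gq <-].
(* The tile [g] of the central supertile and the tile of [T] at a private point of
   [g] both belong to the large supertile, hence coincide. *)
have [S hS kS] := supertile_in_hull k j hT.
have Sg : S g.
  apply: kS; rewrite /supertile -(subnKC mk) iterD.
  by apply: iter_inflateS gq => _ ->.
have [z [e [e0 gz priv]]] := hull_private_point hS Sg.
have t0x : (tile_shift (- x) t0).1 (- x) by apply/mem_tile_shift; rewrite subrr.
have zr : enorm (z + x) < r.
  have := diam_iter _ _ _ _ _ _ _ gq qt0 gz t0x; rewrite opprK => /lt_trans; apply.
  by rewrite ltrDl.
have [t [Tt tz _ St]] := inS _ zr.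
suff <- : tile_shift (- x) t = g by rewrite tile_shiftNK.
apply: priv; first exact: kS.
exists z; split; first by apply/mem_tile_shift; rewrite opprK.
by rewrite /eball/= subrr enorm0.
Qed.

(** Minimality of the hull: [P] lies in a supertile, which lies in the supertiles
    of some larger order whatever their type, and one of these occurs in [T]. *)
Lemma patch_occurs S T P v : hull S -> hull T -> v != 0 ->
  finite_set P -> P `<=` S -> exists c, tiling_shift c P `<=` T.
Proof.
move=> [_ _ patchS] hT v0 Pfin PS.
have [k [j [x Pk]]] := patchS P Pfin PS.
have [k0 sub] := supertile_sub.
have [i [y kT]] := supertile_occurs (k + k0) hT v0.
have [z kz] := sub k i j.
exists (- x + (z + y)); rewrite tiling_shiftD.
apply: subset_trans kT; rewrite tiling_shiftD; apply: tiling_shiftS.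
apply: subset_trans kz; apply: tiling_shiftS.
by rewrite -[supertile _ _](tiling_shiftK x); exact: tiling_shiftS.
Qed.

(** By minimality a large patch of [S] containing [t] and the place of its translate
    by [v] occurs in [T], where the translate is a tile; a private point of that tile
    then identifies it with a tile of the patch. *)
Lemma period_sub S T v : hull S -> hull T -> v != 0 ->
  tiling_shift v T = T -> tiling_shift v S `<=` S.
Proof.
move=> hS hT v0 vT _ [t St <-].
have [M M0 tM] := compact_enorm_bounded (hull_compact hS St).
pose r := M + enorm v.
have rM : M <= r by rewrite lerDl enorm_ge0.
have inball z : (tile_shift v t).1 z -> eball 0 r z.
  move=> /mem_tile_shift/tM; rewrite /eball/= subr0 => zv.
  by have := enorm_triangle (z - v) v; rewrite subrK /r; lra.
have [c cT] := patch_occurs hS hT v0 (hull_locally_finite 0 r hS) (fun _ h => h.1).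
have Tt : T (tile_shift c (tile_shift v t)).
  rewrite -tile_shiftD addrC tile_shiftD -vT; apply: tiling_shift_mem.
  apply: cT; apply: tiling_shift_mem; split => //.
  have [z tz] := hull_nonempty hS St; exists z; split => //.
  by rewrite /eball/= subr0; apply: lt_le_trans rM; exact: tM.
have [z [e [e0 tz priv]]] := hull_private_point hT Tt.
have [p Sp pz] := hull_cover (z - c) hS.
suff <- : p = tile_shift v t by [].
apply: (can_inj (tile_shiftK c)); apply: priv.
  apply: cT; apply: tiling_shift_mem; split => //.
  by exists (z - c); split => //; apply: inball; exact: (mem_tile_shift _ _ _).1 tz.
exists z; split; first exact/mem_tile_shift.
by rewrite /eball/= subrr enorm0.
Qed.

Lemma period_all S T v : hull S -> hull T ->
  tiling_shift v T = T -> tiling_shift v S = S.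
Proof.
move=> hS hT vT; have [->|v0] := eqVneq v 0; first exact: tiling_shift0.
apply/seteqP; split; first exact: period_sub hS hT v0 vT.
rewrite -{1}[S](tiling_shiftK (- v)) opprK; apply: tiling_shiftS.
apply: period_sub hS hT _ _; first by rewrite oppr_eq0.
by rewrite -{1}vT tiling_shiftK.
Qed.

(** If [v] is a period, it is one of the inflated tiling too, and injectivity of
    the inflation makes [lam^-1 *: v] a period. Repeating this yields arbitrarily
    short periods, whereas a translate of a tile by a short vector overlaps it. *)
Lemma aperiodic T v : hull T -> tiling_shift v T = T -> v = 0.
Proof.
move=> hT vT; have [|v0] := eqVneq v 0; first by [].
have lam_neq0 : lam != 0 by rewrite gt_eqF// infl_gt0.
have short n : tiling_shift ((lam ^+ n)^-1 *: v) T = T.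
  elim: n => [|n IH]; first by rewrite expr0 invr1 scale1r.
  apply: (standing_inj hs) => //; first exact: hull_shift.
  rewrite inflate_shift scalerA exprS invfM mulrA divff// mul1r.
  by apply: period_all IH => //; exact: standing_stable.
have [t Tt _] := hull_cover 0 hT.
have [z [r [r0 tz priv]]] := hull_private_point hT Tt.
have [n] := @filter_ex _ _ _ _ (infl_unbounded s (enorm v / r)).
rewrite ltr_pdivrMr// => nr; have l0 : 0 < lam ^+ n by rewrite exprn_gt0// infl_gt0.
have /(hull_tile_shift_inj hT Tt)/eqP : tile_shift ((lam ^+ n)^-1 *: v) t = tile_shift 0 t.
  rewrite tile_shift0; apply: priv; first by rewrite -(short n); exact: tiling_shift_mem.
  exists (z + (lam ^+ n)^-1 *: v); split; first by apply/mem_tile_shift; rewrite addrK.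
  rewrite /eball/= addrAC subrr add0r enormZ ger0_norm ?invr_ge0 ?ltW//.
  by rewrite mulrC ltr_pdivrMr// mulrC.
by rewrite scaler_eq0 invr_eq0 gt_eqF//= => /eqP.
Qed.

Lemma tiling_shift_inj T x y : hull T ->
  tiling_shift x T = tiling_shift y T -> x = y.
Proof.
move=> hT xy; apply/eqP; rewrite -subr_eq0; apply/eqP/(aperiodic hT).
by rewrite tiling_shiftD xy tiling_shiftK.
Qed.

End Hull.

(** * Stable equivalence in the hull *)

Section StableEquivalence.
Variables (R : realType) (d : nat) (L : Type) (s : substitution R d L).
Variables (hs : standing_assumptions s) (eps0 : R).
Variable bracket : Omega s -> Omega s -> Omega s.
Hypothesis eps0_lt : 0 < eps0 < (Num.sqrt 2)^-1.
Hypothesis smale : is_smale_bracket hs eps0 bracket.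
Local Notation pt := 'rV[R]_d.
Local Notation lam := (infl s).
Local Notation Omega := (Omega s).
Local Notation dist := (@Omega_dist R d L s).
Implicit Types (A B S T : Omega) (x y v z : pt).

Lemma Omega_eq S T : sval S = sval T -> S = T.
Proof.
case: S T => [S hS] [T hT] /= ST; rewrite -{T}ST in hT *.
by congr exist; exact: Prop_irrelevance.
Qed.

Lemma sval_iter_omega n S : sval (iter n (omega hs) S) = iter n (inflate s) (sval S).
Proof. by elim: n => //= n ->. Qed.

Let eps0_gt0 : 0 < eps0. Proof. by case/andP: eps0_lt. Qed.
Let eps0_lt1 : eps0 < 1.
Proof. by case/andP: eps0_lt => _ /lt_trans; apply; exact: invsqrt2_lt1. Qed.

Lemma lt_invr (e : R) : 0 < e -> e < 1 -> e < e^-1.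
Proof. by move=> e0 e1; apply: (lt_trans e1); rewrite invf_gt1. Qed.

Lemma dist_lt_close A B e : e <= eps0 -> dist A B < e ->
  exists e' x x', [/\ 0 < e' < e, enorm x < e', enorm x' < e' &
    agree_on (tiling_shift x (sval A)) (tiling_shift x' (sval B)) (eball 0 e'^-1)].
Proof.
move=> ee0 /tdist_ltP[h|[e' e'e [x [x' [xe x'e h]]]]]; last by exists e', x, x'.
by case/andP: eps0_lt => _ /(le_lt_trans ee0)/(lt_trans h); rewrite ltxx.
Qed.

Lemma agree_dist A B e : 0 < e -> agree_on (sval A) (sval B) (eball 0 e^-1) ->
  forall e', e < e' -> dist A B < e'.
Proof.
move=> e0 AB e' ee'; apply/tdist_ltP; right; exists e; first by rewrite e0.
by exists 0, 0; rewrite !enorm0 !tiling_shift0; split.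
Qed.

(** The bracket of [A] and [B] is the translate of [B] by any small vector that
    makes it agree with [A] near the origin, so by aperiodicity there is only one
    such vector. *)
Lemma small_shift_unique A B (e e' : R) x x' y y' :
  0 < e <= eps0 -> enorm x < e -> enorm x' < e ->
  agree_on (tiling_shift x (sval A)) (tiling_shift x' (sval B)) (eball 0 e^-1) ->
  0 < e' <= eps0 -> enorm y < e' -> enorm y' < e' ->
  agree_on (tiling_shift y (sval A)) (tiling_shift y' (sval B)) (eball 0 e'^-1) ->
  x' - x = y' - y.
Proof.
move=> e0 xe x'e ABx e'0 ye y'e ABy; apply: (tiling_shift_inj hs (svalP B)).
rewrite -(bracket_explicit smale e0 xe x'e ABx).
by rewrite -(bracket_explicit smale e'0 ye y'e ABy).
Qed.

Lemma dist_ge0 A B : 0 <= dist A B.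
Proof.
rewrite leNgt; apply/negP => AB.
have /tdist_gt0 : dist A B < dist A B / 2 by lra.
lra.
Qed.

Lemma agree0_iter_le m n (S T : set (tile R d L)) : (m <= n)%N ->
  agree_on (iter m (inflate s) S) (iter m (inflate s) T) [set 0] ->
  agree_on (iter n (inflate s) S) (iter n (inflate s) T) [set 0].
Proof. by move=> mn; rewrite -(subnK mn) !iterD; exact: agree_inflate0. Qed.

(** A point of the local stable set of [A] is its own bracket with [A], hence agrees
    with [A] near the origin without any translation. This puts the pieces of [Rs]
    inside those of [Rprime]. *)
Lemma Gs_agree n A B : Gs hs eps0 bracket n (A, B) ->
  agree_on (iter n (inflate s) (sval A)) (iter n (inflate s) (sval B)) [set 0].
Proof.
rewrite /Gs/Vs/= => -[AB dAB].
have [e [x [x' [/andP[e0 ee0] xe x'e h]]]] := dist_lt_close (lexx _) dAB.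
have ee : 0 < e <= eps0 by rewrite e0 ltW.
have /esym := bracket_explicit smale ee xe x'e h; rewrite AB -{2}[sval _]tiling_shift0.
move=> /(tiling_shift_inj hs (svalP _))/eqP; rewrite subr_eq0 => /eqP xx'.
rewrite -!sval_iter_omega -[sval (iter n _ A)](tiling_shiftK x).
rewrite -[sval (iter n _ B)](tiling_shiftK x) -[X in tiling_shift X (sval (iter n _ B))]xx'.
apply: agree_on_shift0 h; rewrite enormN; apply: lt_trans xe _.
by apply: lt_invr => //; exact: lt_trans eps0_lt1.
Qed.

Lemma agree_Gs n A B r : eps0^-1 < r ->
  agree_on (iter n (inflate s) (sval A)) (iter n (inflate s) (sval B)) (eball 0 r) ->
  Gs hs eps0 bracket n (A, B).
Proof.
move=> r0 AB; have r_gt0 : 0 < r by apply: lt_trans r0; rewrite invr_gt0.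
have re : 0 < r^-1 < eps0.
  by rewrite invr_gt0 r_gt0 -[ltRHS]invrK ltf_pV2 ?posrE ?invr_gt0.
rewrite -!sval_iter_omega -[r]invrK in AB.
split=> /=; last by apply: (agree_dist _ AB); case/andP: re.
case/andP: re => re1 re2; have re : 0 < r^-1 <= eps0 by rewrite re1 ltW.
apply: Omega_eq.
rewrite (bracket_explicit smale (x := 0) (x' := 0) re) ?enorm0 ?tiling_shift0//.
by rewrite subr0 tiling_shift0.
Qed.

Lemma agree_Rs_rel n A B :
  agree_on (iter n (inflate s) (sval A)) (iter n (inflate s) (sval B)) [set 0] ->
  Rs_rel hs (A, B).
Proof.
move=> AB; have hiter (C : Omega) : hull s (iter n (inflate s) (sval C)).
  exact: (hull_iter hs _ (svalP C)).
have [r r0 ABr] := agree_on0_ball hs (hiter A) (hiter B) AB.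
apply/cvgrPdist_lt => e e0; rewrite /=.
have := infl_unbounded s ((e / 2)^-1 / r).
move=> [N _ HN]; exists (N + n)%N => // m /= Nm.
rewrite sub0r normrN ger0_norm ?dist_ge0//.
have e2 : 0 < e / 2 by lra.
apply: (@agree_dist _ _ (e / 2)) => //; last lra.
have /HN/= : (N <= m - n)%N by rewrite leq_subRL ?(leq_trans _ Nm) ?leq_addl// addnC.
rewrite ltr_pdivrMr// => Hr; apply: agree_onS (eballS (ltW Hr)) _.
have -> : m = (m - n + n)%N by rewrite subnK// (leq_trans (leq_addl N n) Nm).
rewrite addnK !sval_iter_omega !iterD.
exact: agree_inflate_ball.
Qed.

(** If the orbits of [A] and [B] approach each other, then for large [n] the
    tilings [omega^n A] and [omega^n B + u_n] agree on a large ball, [u_n] small.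
    Inflating shows that [lam *: u_n] also works at stage [n.+1], so
    [u_(n.+1) = lam *: u_n] by uniqueness; as [u_n] stays bounded, it is [0]. *)
Lemma Rs_rel_agree A B : Rs_rel hs (A, B) -> exists n,
  agree_on (iter n (inflate s) (sval A)) (iter n (inflate s) (sval B)) [set 0].
Proof.
move=> /cvgrPdist_lt AB; have lam1 := infl_gt1 s; have lam0 := infl_gt0 s.
(* With this radius the vectors stay below [eps0] after one inflation. *)
pose e := eps0 / lam; have e0 : 0 < e by rewrite divr_gt0.
have ee0 : e < eps0 by rewrite ltr_pdivrMr// ltr_pMr.
have [N _ HN] := AB e e0.
have close n : exists p : pt * pt, [/\ enorm p.1 < e, enorm p.2 < e &
    agree_on (tiling_shift p.1 (iter (N + n) (inflate s) (sval A)))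
             (tiling_shift p.2 (iter (N + n) (inflate s) (sval B))) (eball 0 e^-1)].
  have /HN/= : (N <= N + n)%N by exact: leq_addr.
  rewrite sub0r normrN ger0_norm ?dist_ge0// => h.
  have [e' [x [x' [/andP[e'0 e'e] xe x'e h']]]] := dist_lt_close (ltW ee0) h.
  exists (x, x'); rewrite -!sval_iter_omega; split => /=.
  - exact: lt_trans e'e.
  - exact: lt_trans e'e.
  - by apply: agree_onS h'; apply: eballS; rewrite lef_pV2 ?posrE// ltW.
have [p Hp] := choice close.
pose u n := (p n).2 - (p n).1.
have uS n : u n.+1 = lam *: u n.
  have [p1 p2 h] := Hp n; have [q1 q2 h'] := Hp n.+1.
  rewrite scalerBr.
  have lt_e x : enorm x < e -> enorm (lam *: x) < eps0.
    by rewrite enormZ gtr0_norm// mulrC -ltr_pdivlMr.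
  have E (C : Omega) : sval (iter (N + n.+1) (omega hs) C) =
      inflate s (iter (N + n) (inflate s) (sval C)).
    by rewrite sval_iter_omega addnS.
  apply: (@small_shift_unique (iter (N + n.+1) (omega hs) A)
    (iter (N + n.+1) (omega hs) B) e eps0).
  - by rewrite e0 ltW.
  - by [].
  - by [].
  - by rewrite !sval_iter_omega.
  - by rewrite eps0_gt0 lexx.
  - exact: lt_e.
  - exact: lt_e.
  - rewrite !E -!inflate_shift; have := agree_inflate_ball s 1 h.
    apply: agree_onS; apply: eballS; rewrite expr1.
    apply: (@le_trans _ _ e^-1); first by rewrite lef_pV2 ?posrE// ltW.
    by rewrite ler_peMl ?invr_ge0 ?ltW.
have un n : u n = lam ^+ n *: u 0%N.
  elim: n => [|n IH]; first by rewrite expr0 scale1r.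
  by rewrite uS IH scalerA -exprS.
have u0 : u 0%N = 0.
  apply: enorm_eq0; apply/eqP; rewrite eq_le enorm_ge0 andbT leNgt; apply/negP => u0.
  have /filter_ex[n] := infl_unbounded s ((e + e) / enorm (u 0%N)).
  rewrite ltr_pdivrMr//; apply/negP; rewrite -leNgt.
  rewrite -[lam ^+ n]gtr0_norm ?exprn_gt0// -enormZ -un.
  have [p1 p2 _] := Hp n; apply: le_trans (enorm_triangle _ _) _.
  by rewrite enormN; lra.
exists N; have [p1 p2] := Hp 0%N; move/eqP: u0; rewrite subr_eq0 => /eqP ->.
rewrite addn0 => h; rewrite -[iter _ _ (sval A)](tiling_shiftK (p 0%N).1).
rewrite -[iter _ _ (sval B)](tiling_shiftK (p 0%N).1).
apply: agree_on_shift0 h; rewrite enormN; apply: lt_trans p1 _.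
by apply: lt_invr => //; exact: lt_trans eps0_lt1.
Qed.

End StableEquivalence.

(** * Sequences in inductive limits *)

Section InductiveLimits.

Lemma indlim_eq (X : topologicalType) (A : set X) (E : nat -> set X)
  (p q : indlim A E) : sval p = sval q -> p = q.
Proof.
case: p q => [x Ax] [y Ay] /= xy; rewrite -{y}xy in Ay *.
by congr exist; exact: Prop_irrelevance.
Qed.

Lemma indlim_cvg (X : topologicalType) (A : set X) (E : nat -> set X) n
    (u : nat -> indlim A E) (l : indlim A E) :
  (\forall k \near \oo, E n (sval (u k))) -> E n (sval l) ->
  sval (u k) @[k --> \oo] --> sval l -> u @ \oo --> l.
Proof.
move=> uE lE ul W; rewrite nbhsE => -[V [oV Vl] VW].
have [V' oV' VV'] : exists2 V' : set X, open V' &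
  forall p : indlim A E, E n (sval p) -> (V p <-> V' (sval p)) by exact: oV.
have : nbhs (sval l) V' by apply: open_nbhs_nbhs; split => //; exact/VV'.
move=> /ul uV'; apply: filterS2 uE uV' => k Ek V'k.
by apply: VW; apply/VV'.
Qed.

(** In a first-countable space each piece is sequential, so that openness in the
    inductive limit can be tested along sequences that stay in one piece. *)
Lemma indlim_open_sequential (R : realType) (X : pseudoMetricType R) (A : set X)
    (E : nat -> set X) (U : set (indlim A E)) :
  (forall n (u : nat -> indlim A E) l, (forall k, E n (sval (u k))) ->
     E n (sval l) -> sval (u k) @[k --> \oo] --> sval l -> U l ->
     exists k, U (u k)) -> open U.
Proof.
move=> Useq; rewrite -[open U]/(indlim_open U) => n.
pose W := [set x : X | forall p : indlim A E, sval p = x -> E n x -> U p].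
exists (interior W) => [|p Ep]; first exact: open_interior.
split=> [Up|/interior_subset Wp]; last exact: Wp.
apply: contrapT => nW.
have far k : exists q : indlim A E,
    [/\ ball (sval p) k.+1%:R^-1 (sval q), E n (sval q) & ~ U q].
  apply: contrapT => nq; apply: nW; apply/nbhs_ballP.
  exists k.+1%:R^-1 => /=; first by rewrite invr_gt0.
  move=> x px q qx Ex; apply: contrapT => nUq; apply: nq.
  by exists q; rewrite qx.
have [u Hu] := choice far.
have [||k] := Useq n u p _ Ep _ Up.
- by move=> k; have [] := Hu k.
- apply/cvg_ballP => e e0.
  have := near_infty_natSinv_lt (PosNum e0); apply: filterS => k /= ke.
  have [h _ _] := Hu k; exact: le_ball (ltW ke) _ h.
- by have [] := Hu k.
Qed.

(** A sequence converging in an inductive limit of T1 spaces stays in one of the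
    pieces: otherwise a subsequence avoiding them one after the other would form
    a closed set. The pieces may be enlarged to an increasing family [D]. *)
Lemma indlim_cvg_bounded (X : topologicalType) (A : set X) (E D : nat -> set X)
    (u : nat -> indlim A E) (l : indlim A E) :
  accessible_space X ->
  (forall n (p : indlim A E), E n (sval p) -> D n (sval p)) ->
  (forall m n, (m <= n)%N -> D m `<=` D n) ->
  (exists n, D n (sval l)) -> u @ \oo --> l ->
  exists n, \forall k \near \oo, D n (sval (u k)).
Proof.
move=> T1 ED Dmono [n0 Dl] ul; apply: contrapT => nD.
have /choice[kap Hkap] n : exists k, (n <= k)%N /\ ~ D (n + n0)%N (sval (u k)).
  apply: contrapT => nk; apply: nD; exists (n + n0)%N; exists n => // k /= nk'.
  by apply: contrapT => nDk; apply: nk; exists k.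
pose C : set (indlim A E) := [set p | exists n, p = u (kap n)].
have oC : open (~` C).
  rewrite -[open _]/(indlim_open (~` C)) => m.
  exists (~` [set sval (u (kap n)) | n in `I_m]).
    apply: closed_openC; apply: (accessible_finite_set_closed.1 T1).
    by apply: finite_image; exact: finite_II.
  move=> p Ep; split=> [nCp [n nm np]|np [n pn]].
    by apply: nCp; exists n; apply: indlim_eq.
  have [nm|mn] := ltnP n m; first by apply: np; exists n => //; rewrite pn.
  have [_] := Hkap n; apply; rewrite -pn.
  apply: (Dmono m); last exact: ED.
  by rewrite (leq_trans mn)// leq_addr.
have : nbhs l (~` C).
  apply: open_nbhs_nbhs; split => // -[n ln]; have [_] := Hkap n; apply.
  by rewrite -ln; apply: Dmono Dl; rewrite leq_addl.
move=> /ul[N _ HN]; apply: (HN (kap N)); last by exists N.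
by have [] := Hkap N.
Qed.

End InductiveLimits.

(** * The leaf of a tiling *)

Section HullSpace.
Variables (R : realType) (d : nat) (L : Type) (s : substitution R d L).
Hypothesis hs : standing_assumptions s.
Local Notation pt := 'rV[R]_d.
Local Notation lam := (infl s).
Local Notation Omega := (Omega s).
Local Notation dist := (@Omega_dist R d L s).
Implicit Types (A B S T : Omega) (x y v z : pt).

Definition translate x T : Omega :=
  exist _ (tiling_shift x (sval T)) (hull_shift x (svalP T)).

Lemma translate_inj T x y : translate x T = translate y T -> x = y.
Proof. by move=> /(congr1 sval)/(tiling_shift_inj hs (svalP T)). Qed.

Lemma dist_translate T x y e : enorm (x - y) < e ->
  dist (translate x T) (translate y T) < e.
Proof.
move=> xye; have e0 : 0 < e by apply: le_lt_trans xye; exact: enorm_ge0.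
pose e' := (enorm (x - y) + e) / 2.
have xye' : enorm (x - y) < e' by rewrite /e'; lra.
have e'0 : 0 < e' by apply: le_lt_trans xye'; exact: enorm_ge0.
apply/tdist_ltP; right; exists e'; first by rewrite e'0 /e'; lra.
exists (y - x), 0; split; rewrite ?enorm0// 1?enormB// -!tiling_shiftD.
by rewrite addr0 addrC subrK.
Qed.

Lemma translate_continuous T : continuous (fun x => translate x T).
Proof.
move=> x W /nbhs_ballP[e /= e0 eW]; apply/nbhs_eballP; exists e => // y xy.
by apply: eW; apply: dist_translate; rewrite enormB.
Qed.

Lemma cvg_translate T (a : nat -> pt) x : a @ \oo --> x ->
  translate (- a k) T @[k --> \oo] --> translate (- x) T.
Proof.
move=> ax; apply: (@cvg_comp _ _ _ (fun k => - a k) (fun z => translate z T) _ (nbhs (- x))).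
  apply/cvg_enormP => r r0; apply: filterS ((cvg_enormP _ _).1 ax r r0) => k ak.
  by rewrite -opprD enormN.
exact: translate_continuous.
Qed.

End HullSpace.

Section FinitePatches.
Variables (R : realType) (d : nat) (L : Type) (s : substitution R d L).
Local Notation pt := 'rV[R]_d.

(** Only finitely many vectors translate one tile of a finite patch to another,
    so small non-zero vectors do not. *)
Lemma finite_patch_rigid (T P : set (tile R d L)) : hull s T -> finite_set P -> P `<=` T ->
  exists2 r, 0 < r & forall t t' v, P t -> P t' -> enorm v < r ->
    t' = tile_shift v t -> v = 0.
Proof.
move=> hT Pfin PT.
pose f (p : tile R d L * tile R d L) : pt := xget 0 [set v | p.2 = tile_shift v p.1].
pose W := [set f p | p in P `*` P] `\ 0.
have clW : closed W.
  apply: (accessible_finite_set_closed.1 (hausdorff_accessible (@norm_hausdorff R 'rV[R]_d))).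
  by apply: finite_setD; apply: finite_image; exact: finite_setX.
have : nbhs (0 : pt) (~` W).
  by apply: open_nbhs_nbhs; split; [exact: closed_openC|case=> _; apply].
move=> /nbhs_eballP[r r0 rW]; exists r => // t t' v Pt Pt' vr t'E.
apply: contrapT => v0; apply: (rW v); first by rewrite /eball/= subr0.
split => //; exists (t, t') => //=; rewrite /f /=.
apply: xget_unique => // w t'w.
by apply: (hull_tile_shift_inj hT (PT _ Pt)); rewrite -t'E.
Qed.

End FinitePatches.

Section Leaves.
Variables (R : realType) (d : nat) (L : Type) (s : substitution R d L).
Variables (hs : standing_assumptions s) (eps0 : R).
Variable bracket : Omega s -> Omega s -> Omega s.
Hypothesis eps0_lt : 0 < eps0 < (Num.sqrt 2)^-1.
Hypothesis smale : is_smale_bracket hs eps0 bracket.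
Local Notation pt := 'rV[R]_d.
Local Notation lam := (infl s).
Local Notation Omega := (Omega s).
Local Notation dist := (@Omega_dist R d L s).
Implicit Types (A B S T : Omega) (x y v z : pt).

Let eps0_gt0 : 0 < eps0. Proof. by case/andP: eps0_lt. Qed.
Let eps0_lt1 : eps0 < 1.
Proof. by case/andP: eps0_lt => _ /lt_trans; apply; exact: invsqrt2_lt1. Qed.

(** The small vector by which [A] and [B] differ on larger and larger balls is
    always the same one, hence it is zero. *)
Lemma Omega_separated A B : (forall e, 0 < e -> dist A B < e) -> A = B.
Proof.
move=> AB.
have close e : 0 < e -> exists e' x x',
    [/\ 0 < e' < Num.min e eps0, enorm x < e', enorm x' < e' &
    agree_on (tiling_shift x (sval A)) (tiling_shift x' (sval B)) (eball 0 e'^-1)].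
  move=> e0; apply: (dist_lt_close eps0_lt); first by rewrite ge_min lexx orbT.
  by apply: AB; rewrite lt_min e0.
have [e1 [x1 [x1' []]]] := close _ ltr01; rewrite lt_min.
move=> /andP[e10 /andP[_ e1e]] x1e x1'e h1.
have uniq e : 0 < e -> exists e' x, [/\ 0 < e' < Num.min e eps0, enorm x < e' &
    agree_on (tiling_shift x (sval A)) (tiling_shift x (sval B)) (eball 0 e'^-1)].
  have small e' x x' : 0 < e' < eps0 -> enorm x < e' -> enorm x' < e' ->
      agree_on (tiling_shift x (sval A)) (tiling_shift x' (sval B)) (eball 0 e'^-1) ->
      x' - x = x1' - x1.
    move=> /andP[e'0 e'e] xe x'e h.
    apply: (small_shift_unique smale _ xe x'e h _ x1e x1'e h1).
      by rewrite e'0 ltW.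
    by rewrite e10 ltW.
  have u0 : x1' - x1 = 0.
    apply: enorm_eq0; apply/eqP; rewrite eq_le enorm_ge0 andbT leNgt; apply/negP => u0.
    have [|e' [x [x' []]]] := close (enorm (x1' - x1) / 2); first by lra.
    rewrite lt_min => /andP[e'0 /andP[e'u e'e]] xe x'e h.
    have := enorm_triangle x' (- x); rewrite (small e') ?e'0// enormN; lra.
  move=> /close[e' [x [x' [he' xe x'e h]]]]; exists e', x; split => //.
  suff xx' : x' = x by rewrite xx' in h.
  apply/eqP; rewrite -subr_eq0 -u0; apply/eqP; apply: (small e') => //.
  by move: he'; rewrite lt_min => /andP[-> /andP[]].
have agree r : agree_on (sval A) (sval B) (eball 0 r).
  have r0 : 0 < `|r| + 1 by rewrite ltr_pwDr.
  have [|e [x [he xe h]]] := uniq (`|r| + 1)^-1; first by rewrite invr_gt0.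
  move: he; rewrite lt_min => /andP[e0 /andP[er ee]].
  rewrite -[sval A](tiling_shiftK x) -[sval B](tiling_shiftK x).
  apply: agree_on_shift_ball h; rewrite enormN.
  have : `|r| + 1 < e^-1 by rewrite -[ltLHS]invrK ltf_pV2 ?posrE ?invr_gt0.
  by have := ler_norm r; have := eps0_lt1; lra.
have sub S S' : (forall r, agree_on (sval S) (sval S') (eball 0 r)) -> sval S `<=` sval S'.
  move=> SS' t St; have [z tz] := hull_nonempty (svalP S) St.
  have : patch_at (sval S) (eball 0 (enorm z + 1)) t.
    by split => //; exists z; split => //; rewrite /eball/= subr0 ltrDl ltr01.
  by rewrite SS' => -[].
by apply: Omega_eq; apply/seteqP; split; apply: sub => // r; exact: (esym (agree r)).
Qed.

Lemma Omega_hausdorff : hausdorff_space Omega.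
Proof.
move=> A B AB; apply: Omega_separated => e e0.
have e2 : 0 < e / 2 by lra.
have [||C [AC BC]] := AB (ball A (e / 2)) (ball B (e / 2)).
- exact: nbhsx_ballx.
- exact: nbhsx_ballx.
have := tdist_triangle AC (tdist_sym BC).
by rewrite -splitr.
Qed.

Lemma Omega2_accessible : accessible_space (Omega * Omega)%type.
Proof.
apply: hausdorff_accessible => p q pq.
suff [h1 h2] : p.1 = q.1 /\ p.2 = q.2 by case: p q h1 h2 {pq} => [? ?] [? ?] /= -> ->.
split; apply: Omega_hausdorff => U V pU qV.
  have [||r [Ur Vr]] := pq (fst @^-1` U) (fst @^-1` V).
  - exact: (@cvg_fst _ _ (nbhs p.1) (nbhs p.2)).
  - exact: (@cvg_fst _ _ (nbhs q.1) (nbhs q.2)).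
  by exists r.1.
have [||r [Ur Vr]] := pq (snd @^-1` U) (snd @^-1` V).
- exact: (@cvg_snd _ _ (nbhs p.1) (nbhs p.2)).
- exact: (@cvg_snd _ _ (nbhs q.1) (nbhs q.2)).
by exists r.2.
Qed.

(** A bounded part of the leaf is the injective continuous image of a compact
    ball, so that on it the distance of [Omega] controls the translation vector. *)
Lemma dist_translate_lower_bound T x r y : enorm (y - x) < r -> forall M : R,
  exists2 e, 0 < e & forall z, enorm z <= M ->
    dist (translate (- y) T) (translate z T) < e -> enorm (- z - x) < r.
Proof.
move=> yx M; pose K := [set z : pt | enorm z <= M] `&` [set z | r <= enorm (z + x)].
have cK : compact K.
  apply: (subclosed_compact _ (@compact_enorm_le R d M)) => [|z []//].
  apply: closedI; first exact: closed_enorm_le.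
  apply: (@preimage_closed _ _ (fun z => enorm (z + x)) [set w | r <= w]); last first.
    exact: closed_ge.
  move=> z _; apply: (@continuous_comp _ _ _ (fun z => z + x) (@enorm R d)).
    exact: translation_continuous.
  exact: enorm_continuous.
have [e [e0 He]] : exists e, 0 < e /\
    K `<=` [set z | ~ dist (translate (- y) T) (translate z T) < e].
  apply: (@filter_ex _ (0 : R)^'+); apply: filterI; first exact: nbhs_right_gt.
  apply: ((compact_near_coveringP K).1 cK R (0 : R)^'+
    (fun e z => ~ dist (translate (- y) T) (translate z T) < e)) => z [zM zr].
  have : exists2 e, 0 < e & ~ dist (translate (- y) T) (translate z T) < e.
    apply: contrapT => h.
    have : translate (- y) T = translate z T.
      by apply: Omega_separated => e e0; apply: contrapT => h'; apply: h; exists e.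
    move=> /(translate_inj hs) yz; move: zr yx; rewrite -yz /= addrC -enormB.
    by move=> /le_lt_trans/[apply]; rewrite ltxx.
  move=> [e e0 yz].
  exists (eball z (e / 2), [set e' | e' < e / 2]); first split => /=.
  - by apply: nbhs_eball; lra.
  - by apply: nbhs_right_lt; lra.
  move=> [z' e'] [/= zz' e'e] yz'; apply: yz.
  have -> : e = e / 2 + e / 2 by lra.
  apply: tdist_triangle (_ : tdist _ (sval (translate z' T)) < _) _.
    exact: lt_trans e'e.
  exact: dist_translate.
exists e => // z zM yz; rewrite -opprD enormN ltNge; apply/negP => zr.
by apply: (He z).
Qed.

(** The sets of translates by vectors of an open ball are open in the leaf, since
    each piece [Vu n] involves bounded vectors only. In the topology of [Omega] this
    would fail, as far away vectors bring [T] back near itself. *)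
Lemma leaf_cvg (T : Omega) (u : nat -> leaf eps0 T) (l : leaf eps0 T) (a : nat -> pt) x :
  (forall k, sval (u k) = translate (- a k) T) -> sval l = translate (- x) T ->
  u @ \oo --> l -> a @ \oo --> x.
Proof.
move=> uE lE ul; apply/cvg_enormP => r r0.
pose V : set (leaf eps0 T) :=
  [set p | exists2 y, sval p = translate (- y) T & enorm (y - x) < r].
have oV : open V.
  rewrite -[open V]/(indlim_open V) => n.
  exists (interior [set S : Omega | Vu eps0 T n S ->
      exists2 y, S = translate (- y) T & enorm (y - x) < r]).
    exact: open_interior.
  move=> p Ep; split=> [[y pE yx]|/interior_subset]; last by apply.
  have [e e0 He] := dist_translate_lower_bound T yx (2 * eps0 * lam ^+ n).
  apply/nbhs_ballP; exists e => //= S; rewrite pE => yS [z zM SE].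
  exists (- z); first by apply: Omega_eq; rewrite opprK.
  apply: He; first exact: ltW.
  suff -> : translate z T = S by [].
  exact: Omega_eq.
have : nbhs l V.
  apply: open_nbhs_nbhs; split => //; exists x => //.
  by rewrite subrr enorm0.
move=> /ul uV; have {}uV : \forall k \near \oo, V (u k) by exact: uV.
apply: filterS uV => k [y]; rewrite uE => /(translate_inj hs)/oppr_inj ->.
by [].
Qed.

Lemma cvg_leaf (T : Omega) (u : nat -> leaf eps0 T) (l : leaf eps0 T) (a : nat -> pt) x :
  (forall k, sval (u k) = translate (- a k) T) -> sval l = translate (- x) T ->
  a @ \oo --> x -> u @ \oo --> l.
Proof.
move=> uE lE ax.
have e0 : 0 < 2 * eps0 by exact: mulr_gt0.
have /filter_ex[n] := infl_unbounded s ((enorm x + 1) / (2 * eps0)).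
rewrite ltr_pdivrMr// mulrC => xn.
apply: (@indlim_cvg _ _ _ n).
- apply: filterS ((cvg_enormP _ _).1 ax 1 ltr01) => k ak.
  exists (- a k); last by rewrite uE.
  rewrite enormN; apply: lt_trans xn.
  by have := enorm_triangle (a k - x) x; rewrite subrK; lra.
- exists (- x); last by rewrite lE.
  by rewrite enormN; lra.
by rewrite lE; under eq_fun do rewrite uE; exact: cvg_translate.
Qed.

End Leaves.

(** * The isomorphism *)

Section Isomorphism.
Variables (R : realType) (d : nat) (L : Type) (s : substitution R d L).
Variables (hs : standing_assumptions s) (eps0 : R).
Variable bracket : Omega s -> Omega s -> Omega s.
Hypothesis eps0_lt : 0 < eps0 < (Num.sqrt 2)^-1.
Hypothesis smale : is_smale_bracket hs eps0 bracket.
Variable T : Omega s.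
Local Notation pt := 'rV[R]_d.
Local Notation lam := (infl s).
Local Notation Omega := (Omega s).
Local Notation Rp := (Rprime s (sval T)).
Local Notation Hs := (Hs_space hs eps0 bracket T).
Local Notation RnT := (Rn s (sval T)).

Definition leaf_pair (p : pt * pt) : Omega * Omega :=
  (translate (- p.1) T, translate (- p.2) T).

Lemma leaf_pair_inj : injective leaf_pair.
Proof.
move=> [x y] [x' y'] xy; have /= h1 := congr1 fst xy; have /= h2 := congr1 snd xy.
by rewrite (oppr_inj (translate_inj hs h1)) (oppr_inj (translate_inj hs h2)).
Qed.

Lemma Rprime_Rs p : Rprime_rel s (sval T) p <-> Rs_rel hs (leaf_pair p).
Proof.
split=> [[n _ pn]|/(Rs_rel_agree eps0_lt smale)[n pn]]; last by exists n.
exact: (agree_Rs_rel hs (A := translate _ T) (B := translate _ T) pn).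
Qed.

Lemma leaf_pair_surj q : Hs_rel hs T q ->
  exists2 p, Rprime_rel s (sval T) p & leaf_pair p = q.
Proof.
move=> [q_Rs [[x qx] [y qy]]].
have pq : leaf_pair (- x, - y) = q.
  case: q {q_Rs} qx qy => [A B] /= Ax By; rewrite /leaf_pair /= !opprK.
  by congr pair; exact: Omega_eq.
by exists (- x, - y) => //; apply/Rprime_Rs; rewrite pq.
Qed.

Lemma leaf_pair_Hs p : Rprime_rel s (sval T) p -> Hs_rel hs T (leaf_pair p).
Proof.
move=> /Rprime_Rs pR; split => //.
by split; [exists (- p.1)|exists (- p.2)].
Qed.

Definition leaf_arrow (p : Rp) : Hs := exist _ (leaf_pair (sval p)) (leaf_pair_Hs (svalP p)).

Lemma leaf_arrow_inj : injective leaf_arrow.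
Proof. by move=> p q /(congr1 sval)/leaf_pair_inj; exact: indlim_eq. Qed.

Lemma leaf_arrow_surj (h : Hs) : exists p, leaf_arrow p = h.
Proof.
case: h => q hq; have [p Rp_p pq] := leaf_pair_surj hq.
exists (exist _ p Rp_p); rewrite /leaf_arrow; move: (leaf_pair_Hs _) => /=.
by rewrite pq => hq'; congr exist; exact: Prop_irrelevance.
Qed.

Lemma Rn_le m n : (m <= n)%N -> RnT m `<=` RnT n.
Proof. by move=> mn p; exact: agree0_iter_le. Qed.

Lemma Rprime_eqrel : is_eqrel_on setT (Rprime_rel s (sval T)).
Proof.
split=> // [x _|x y [n _ xy]|x y z [m _ xy] [n _ yz]].
- by exists 0%N.
- by exists n => //; exact: esym.
exists (maxn m n) => //.
have /= xy' := Rn_le (leq_maxl m n) xy; have /= yz' := Rn_le (leq_maxr m n) yz.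
exact: etrans xy' yz'.
Qed.

Lemma Hs_eqrel : is_eqrel_on (leaf_set T) (Hs_rel hs T).
Proof.
have [_ rf sy tr] := Rprime_eqrel.
split=> [A B [_ []] //|A [x Ax]|A B|A B C].
- have -> : (A, A) = leaf_pair (- x, - x).
    by rewrite /leaf_pair/= opprK; congr pair; exact: Omega_eq.
  by apply: leaf_pair_Hs; exact: rf.
- by move=> /leaf_pair_surj[[x y] /sy xy [<- <-]]; exact: (leaf_pair_Hs xy).
- move=> /leaf_pair_surj[[x y] xy [<- <-]] /leaf_pair_surj[[y' z] yz [yy' <-]].
  have yE : y' = y by apply: oppr_inj; apply: (@translate_inj _ _ _ _ hs T); exact: Omega_eq.
  by rewrite yE in yz; exact: (leaf_pair_Hs (tr _ _ _ xy yz)).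
Qed.

Lemma leaf_arrow_groupoid_iso : groupoid_iso setT (leaf_set T) leaf_arrow.
Proof.
have [g gK] := choice leaf_arrow_surj.
have inj x y : translate (- x) T = translate (- y) T -> x = y.
  by move=> /(translate_inj hs)/oppr_inj.
split; [exact: Rprime_eqrel|exact: Hs_eqrel| | |].
- by exists g => // p; apply: leaf_arrow_inj; rewrite gK.
- move=> [p ?] [q ?] [r ?]; rewrite /arrow_comp /=; split=> -[pq rE].
    by rewrite rE pq.
  by split; [exact: inj|exact: leaf_pair_inj].
- move=> [p ?] [q ?]; rewrite /arrow_inv /=; split=> [->//|pq].
  exact: leaf_pair_inj.
Qed.

Lemma iter_inflate_translate n x :
  iter n (inflate s) (tiling_shift (- x) (sval T)) =
  tiling_shift (- (lam ^+ n *: x)) (iter n (inflate s) (sval T)).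
Proof. by rewrite iter_inflate_shift scalerN. Qed.

(** Near one of its points [Rn n] consists of diagonal translates: close to the
    origin the tiles of the two patches are small translates of the common finite
    patch, which is rigid. *)
Lemma Rn_etale n p : RnT n p -> exists2 r, 0 < r &
  forall q, RnT n q -> enorm (q.1 - p.1) < r -> enorm (q.2 - p.2) < r ->
    q.1 - p.1 = q.2 - p.2.
Proof.
rewrite /Rn/= !iter_inflate_translate; set X := iter n _ _.
set A := tiling_shift _ X; set B := tiling_shift _ X => AB.
have hX : hull s X by exact: (hull_iter hs _ (svalP T)).
have hA : hull s A by exact: hull_shift.
have hB : hull s B by exact: hull_shift.
have [rA rA0 sepA] := hull_separated hs 0 hA.
have [rB rB0 sepB] := hull_separated hs 0 hB.
have Pfin : finite_set (patch_at A [set 0]).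
  apply: sub_finite_set (hull_locally_finite hs 0 1 hA) => t [At [z [tz z0]]].
  by split => //; exists z; split => //; rewrite z0 /eball/= subrr enorm0.
have [rP rP0 rigid] := finite_patch_rigid hA Pfin (fun _ h => h.1).
have l0 : 0 < lam ^+ n by rewrite exprn_gt0// infl_gt0.
exists (Num.min (Num.min rA rB) (rP / 2) / lam ^+ n).
  by rewrite divr_gt0// !lt_min rA0 rB0/=; lra.
move=> q; rewrite !iter_inflate_translate -/X => qn; rewrite !ltr_pdivlMr// !lt_min.
pose a := lam ^+ n *: (q.1 - p.1); pose b := lam ^+ n *: (q.2 - p.2).
have ea (z : pt) : enorm z * lam ^+ n = enorm (lam ^+ n *: z).
  by rewrite enormZ gtr0_norm// mulrC.
rewrite !ea -/a -/b => /andP[/andP[aA _] aP] /andP[/andP[_ bB] bP].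
have Ea : tiling_shift (- (lam ^+ n *: q.1)) X = tiling_shift (- a) A.
  by rewrite -tiling_shiftD -opprD -scalerDr addrC subrK.
have Eb : tiling_shift (- (lam ^+ n *: q.2)) X = tiling_shift (- b) B.
  by rewrite -tiling_shiftD -opprD -scalerDr addrC subrK.
rewrite Ea Eb in qn.
have [t At t0] := hull_cover 0 (hull_shift (- a) hA).
have : patch_at (tiling_shift (- a) A) [set 0] t by split => //; exists 0.
rewrite qn => -[/mem_tiling_shift Bt _]; move/mem_tiling_shift: At => At.
rewrite !opprK in At Bt.
have A0 : patch_at A [set 0] (tile_shift a t).
  split => //; exists 0; split => //; apply: sepA => //.
  by exists a; split; [apply/mem_tile_shift; rewrite subrr|rewrite /eball/= subr0].
have B0 : patch_at A [set 0] (tile_shift b t).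
  rewrite AB; split => //; exists 0; split => //; apply: sepB => //.
  by exists b; split; [apply/mem_tile_shift; rewrite subrr|rewrite /eball/= subr0].
have /eqP : b - a = 0.
  apply: (rigid _ _ _ A0 B0).
    by have := enorm_triangle b (- a); rewrite enormN; lra.
  by rewrite -tile_shiftD addrC subrK.
by rewrite subr_eq0 => /eqP/(scalerI (lt0r_neq0 l0)).
Qed.

Lemma cvg_coordinates (u : nat -> pt * pt) (l : pt * pt) : u @ \oo --> l ->
  ((fun k => (u k).1) @ \oo --> l.1) /\ ((fun k => (u k).2) @ \oo --> l.2).
Proof.
case: l => [x y] ul; split.
  by apply: (@cvg_comp _ _ _ u fst _ _ _ ul); exact: cvg_fst.
by apply: (@cvg_comp _ _ _ u snd _ _ _ ul); exact: cvg_snd.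
Qed.

(** Along a sequence converging inside [Rn n] the two tilings eventually differ
    from those of the limit by the same small translation, so they agree on a
    fixed ball; inflating it puts all the pairs in a single [Gs m]. *)
Lemma Rn_Gs n (u : nat -> pt * pt) (l : pt * pt) :
  (forall k, RnT n (u k)) -> RnT n l -> u @ \oo --> l ->
  exists m, (\forall k \near \oo, Gs hs eps0 bracket m (leaf_pair (u k))) /\
            Gs hs eps0 bracket m (leaf_pair l).
Proof.
move=> un ln ul; have [r r0 etale] := Rn_etale ln.
have [ul1 ul2] := cvg_coordinates ul.
have l0 : 0 < lam ^+ n by rewrite exprn_gt0// infl_gt0.
have [r' r'0 lr] := agree_on0_ball hs (hull_iter hs n (hull_shift (- l.1) (svalP T)))
  (hull_iter hs n (hull_shift (- l.2) (svalP T))) ln.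
have /filter_ex[j] := infl_unbounded s (eps0^-1 / (r' / 2)).
have r'2 : 0 < r' / 2 by lra.
rewrite ltr_pdivrMr// => jr; exists (j + n)%N.
have GsP q : agree_on (iter n (inflate s) (tiling_shift (- q.1) (sval T)))
    (iter n (inflate s) (tiling_shift (- q.2) (sval T))) (eball 0 (r' / 2)) ->
    Gs hs eps0 bracket (j + n)%N (leaf_pair q).
  move=> qr; apply: (agree_Gs eps0_lt smale
    (A := translate (- q.1) T) (B := translate (- q.2) T) jr).
  rewrite !iterD.
  exact: agree_inflate_ball.
split; last by apply: GsP; apply: agree_onS lr; apply: eballS; lra.
have r2 : 0 < r' / 2 / lam ^+ n by rewrite divr_gt0.
have {}ul1 := (cvg_enormP _ _).1 ul1; have {}ul2 := (cvg_enormP _ _).1 ul2.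
apply: filterS2 (filterI (ul1 r r0) (ul2 r r0)) (ul1 _ r2) => k [u1 u2] u1'.
apply: GsP; have uE := etale (u k) (un k) u1 u2.
have E x y : tiling_shift (- y) (sval T) =
    tiling_shift (- (y - x)) (tiling_shift (- x) (sval T)).
  by rewrite -tiling_shiftD -opprD addrC subrK.
rewrite (E l.1 (u k).1) (E l.2 (u k).2) -uE !(iter_inflate_shift s n (- ((u k).1 - l.1))).
apply: agree_on_shift_ball lr; rewrite scalerN enormN enormZ gtr0_norm//.
by move: u1'; rewrite ltr_pdivlMr// mulrC; lra.
Qed.

Lemma leaf_arrow_cvg n (u : nat -> Rp) (l : Rp) :
  (forall k, RnT n (sval (u k))) -> RnT n (sval l) ->
  sval (u k) @[k --> \oo] --> sval l ->
  Hs_cvg (fun k => leaf_arrow (u k)) (leaf_arrow l).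
Proof.
move=> un ln ul; have [ul1 ul2] := cvg_coordinates ul; split.
- have [m [um lm]] := Rn_Gs un ln ul.
  apply: (@indlim_cvg _ _ _ m) => //=.
  exact: cvg_pair (cvg_translate (T := T) ul1) (cvg_translate (T := T) ul2).
- exact: (cvg_leaf eps0_lt _ _ ul1).
- exact: (cvg_leaf eps0_lt _ _ ul2).
Qed.

(** Convergence in the leaf gives the coordinates, and convergence in [Rs] confines
    the sequence to a single piece. *)
Lemma leaf_arrow_cvg_inv (u : nat -> Rp) (l : Rp) :
  Hs_cvg (fun k => leaf_arrow (u k)) (leaf_arrow l) -> u @ \oo --> l.
Proof.
move=> [uRs u1 u2].
have ul1 : (fun k => (sval (u k)).1) @ \oo --> (sval l).1.
  exact: (leaf_cvg eps0_lt smale _ _ u1).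
have ul2 : (fun k => (sval (u k)).2) @ \oo --> (sval l).2.
  exact: (leaf_cvg eps0_lt smale _ _ u2).
pose D n := [set q : Omega * Omega | agree_on (iter n (inflate s) (sval q.1))
  (iter n (inflate s) (sval q.2)) [set 0]].
have lD : exists n, D n (leaf_pair (sval l)) by have [n _ ln] := svalP l; exists n.
have [||m um] := @indlim_cvg_bounded _ _ (Gs hs eps0 bracket) D _
  (Hs_to_Rs (leaf_arrow l)) (Omega2_accessible eps0_lt smale) _ _ lD uRs.
- by move=> n [[A B] h] /= /(Gs_agree eps0_lt smale).
- by move=> i j ij q; exact: agree0_iter_le.
have [n ln] := lD; apply: (@indlim_cvg _ _ _ (maxn m n)).
- by apply: filterS um => k; apply: Rn_le; exact: leq_maxl.
- by apply: Rn_le ln; exact: leq_maxr.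
have E k : sval (u k) = ((sval (u k)).1, (sval (u k)).2) by case: (sval (u k)).
by rewrite (funext E) [X in _ --> X]surjective_pairing; exact: cvg_pair ul1 ul2.
Qed.

(** Openness in the target is sequential by definition, and in the source by first
    countability of the pieces, so it suffices to compare convergent sequences. *)
Lemma leaf_arrow_homeomorphism : homeomorphism leaf_arrow.
Proof.
have [g gK] := choice leaf_arrow_surj; split.
  apply/continuousP => W oW; apply: indlim_open_sequential => n u l un ln ul Wl.
  have : \forall k \near \oo, W (leaf_arrow (u k)).
    exact: oW (leaf_arrow_cvg un ln ul) Wl.
  by move=> /filter_ex.
exists g; split => // [|p]; last by apply: leaf_arrow_inj; rewrite gK.
apply/continuousP => W oW; rewrite -[open _]/(Hs_open (g @^-1` W)) => u h uh Wh.
have /leaf_arrow_cvg_inv gu : Hs_cvg (fun k => leaf_arrow (g (u k))) (leaf_arrow (g h)).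
  by rewrite gK; under eq_fun do rewrite gK.
by apply: gu; exact: open_nbhs_nbhs.
Qed.

End Isomorphism.

Theorem proposition3p5 (R : realType) (d : nat) (L : Type)
    (s : substitution R d L) (hs : standing_assumptions s)
    (eps0 : R) (bracket : Omega s -> Omega s -> Omega s) (T : Omega s) :
  (0 < d)%N ->
  0 < eps0 < (Num.sqrt 2)^-1 ->
  is_smale_bracket hs eps0 bracket ->
  exists F : Rprime s (sval T) -> Hs_space hs eps0 bracket T,
    [/\ forall p : Rprime s (sval T),
          sval (sval (F p)).1 = tiling_shift (- (sval p).1) (sval T) /\
          sval (sval (F p)).2 = tiling_shift (- (sval p).2) (sval T),
        groupoid_iso setT (leaf_set T) F &
        homeomorphism F].
Proof.
move=> d0 eps0_lt smale; exists (leaf_arrow eps0_lt smale (T := T)).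
split; [by []|exact: leaf_arrow_groupoid_iso|exact: leaf_arrow_homeomorphism].
Qed.
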